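(* Let $\dim$ denote any one (fixed) of the Hausdorff dimension $\dim_H$, the packing dimension $\dim_P$, or the box dimension $\dim_B$. Let $1\le\beta\le 2$. Then the set $$S_\beta:=\{f\in\mathcal{C}[0,1] : \dim G_f=\beta\}$$ is dense in $\mathcal{C}[0,1]$ with respect to the supremum norm.
   Context: $\mathcal{C}[0,1]$ is the space of continuous functions $f:[0,1]\to\mathbb{R}$, endowed with the supremum norm $\|\cdot\|_\infty$. $G_f=\{(x,f(x)):x\in[0,1]\}\subset\mathbb{R}^2$ denotes the graph of $f$, where $\mathbb{R}^2$ has the Euclidean metric. For a bounded nonempty set $F$, let $N_\delta(F)$ be the smallest number of sets of diameter at most $\delta$ covering $F$. The box dimension is $\dim_B F=\lim_{\delta\to0^+}\frac{\log N_\delta(F)}{-\log\delta}$ whenever this limit exists; the statement $\dim_B F=\beta$ means that the limit exists and equals $\beta$. The Hausdorff dimension is $\dim_H F=\inf\{s\ge 0:H^s(F)=0\}$, where $H^s$ is the $s$-dimensional Hausdorff measure. The packing dimension is $\dim_P F=\inf\{s\ge 0:\mathcal{P}^s(F)=0\}$, where $\mathcal{P}^s(F)=\inf\{\sum_{i}\mathcal{P}^s_0(F_i): F\subseteq\bigcup_{i=1}^\infty F_i\}$, $\mathcal{P}^s_0(F)=\lim_{\delta\to0^+}\mathcal{P}^s_\delta(F)$, and $\mathcal{P}^s_\delta(F)$ is the supremum of $\sum_i|B_i|^s$ ($|B_i|$ the diameter of $B_i$) over countable collections $\{B_i\}$ of disjoint balls of radii at most $\delta$ with centres in $F$. *)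

(* Defs.v *)
From HB Require Import structures.
From mathcomp Require Import all_boot all_order all_algebra.
From mathcomp Require Import all_classical all_reals all_analysis.
Set Implicit Arguments.
Unset Strict Implicit.
Unset Printing Implicit Defensive.
Import Order.TTheory GRing.Theory Num.Theory.
Import numFieldNormedType.Exports.
Local Open Scope classical_set_scope.
Local Open Scope ring_scope.

(* The space C[0,1]. The library already puts a topology on [continuousType]
   (pointwise convergence); [C01] is a separate constant so that its topology
   is instead the one of the supremum distance, declared below. *)
Definition C01 (R : realType) := continuousType `[0, 1 : R]%classic R.

Definition C01_fun (R : realType) (f : C01 R) : `[0, 1 : R]%classic -> R := f.
Coercion C01_fun : C01 >-> Funclass.

HB.instance Definition _ (R : realType) :=
  Choice.copy (C01 R) (continuousType `[0, 1 : R]%classic R).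

(* A supremum in [R], meaningful for bounded [g]; it is only applied to
   differences of continuous functions, see [has_sup_C01]. *)
Definition supnorm (R : realType) (g : `[0, 1 : R]%classic -> R) : R :=
  sup (range (fun x => `|g x|)).

Definition supdist (R : realType) (f g : C01 R) : R :=
  supnorm (fun x => f x - g x).

Section sup_metric.
Context {R : realType}.
Implicit Types f g h : C01 R.

Lemma has_sup_C01 f g : has_sup (range (fun x => `|f x - g x|)).
Proof.
have in01 : (0 : R) \in `[0, 1]%classic by rewrite inE/= in_itv/= lexx ler01.
split; first by exists `|f (exist _ 0 in01) - g (exist _ 0 in01)|, (exist _ 0 in01).
pose u x := `|f x - g x|.
have cu : continuous u.
  move=> x; apply: (@continuous_comp _ _ _ (fun x => f x - g x) Num.norm).
    apply: (@cvgB _ _ _ (nbhs x) (nbhs_filter x) f g); exact: cts_fun.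
  exact: norm_continuous.
have /(EVT_max ler01)[c _ Mc] : {within `[0, 1 : R], continuous (valL_ (0 : R) u)}.
  exact/subspace_valL_continuousP'.
exists (valL_ (0 : R) u c) => _ [x _ <-].
rewrite -[leLHS]/(u x); have <- : valL_ (0 : R) u (set_val x) = u x.
  by rewrite -[in RHS](valLK 0 u).
exact: Mc (set_valP x).
Qed.

Lemma le_supdist f g x : `|f x - g x| <= supdist f g.
Proof. by apply: sup_upper_bound; [exact: has_sup_C01|exists x]. Qed.

Lemma supdist_le f g (M : R) :
  (forall x, `|f x - g x| <= M) -> supdist f g <= M.
Proof.
by move=> fgM; apply: ge_sup; [case: (has_sup_C01 f g)|move=> _ [x _ <-]].
Qed.

Lemma supdistxx f : supdist f f = 0.
Proof.
apply/eqP; rewrite eq_le; apply/andP; split.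
  by apply: supdist_le => x; rewrite subrr normr0.
have [[_ [x _ _]] _] := has_sup_C01 f f.
exact: le_trans (le_supdist f f x).
Qed.

Lemma supdist_eq0 f g : supdist f g = 0 -> f = g.
Proof.
move=> fg0; apply/continuousEP => x; apply/eqP.
by have := le_supdist f g x; rewrite fg0 normr_le0 subr_eq0.
Qed.

Lemma supdist_sym f g : supdist f g = supdist g f.
Proof.
apply/eqP; rewrite eq_le.
by apply/andP; split; apply: supdist_le => x; rewrite distrC le_supdist.
Qed.

Lemma supdist_triangle g f h : supdist f h <= supdist f g + supdist g h.
Proof.
apply: supdist_le => x; rewrite (le_trans (ler_distD (g x) _ _))//.
by rewrite lerD// le_supdist.
Qed.

End sup_metric.

HB.instance Definition _ (R : realType) := @isMetric.Build R (C01 R)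
  (@supdist R) (@supdistxx R) (@supdist_eq0 R) (@supdist_sym R)
  (@supdist_triangle R).

Definition graph01 (R : realType) (f : C01 R) : set (R * R) :=
  [set (set_val x, f x) | x in [set: `[0, 1 : R]%classic]].

(* The library's metric on [R * R] is the maximum one, not the Euclidean one. *)
Definition euclid_dist (R : realType) (p q : R * R) : R :=
  Num.sqrt ((p.1 - q.1) ^+ 2 + (p.2 - q.2) ^+ 2).

Definition closed_disc (R : realType) (c : R * R) (r : R) : set (R * R) :=
  [set p | euclid_dist c p <= r].

(* Including 0 only serves to give the empty set diameter 0. *)
Definition diameter (R : realType) (A : set (R * R)) : \bar R :=
  ereal_sup ([set 0%E] `|` [set (euclid_dist p q)%:E | p in A & q in A]).

Section dimensions.
Context {R : realType}.
Implicit Types (F : set (R * R)) (s delta : R).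
Local Open Scope ereal_scope.

(* Countable families are indexed by an arbitrary set [D] of naturals, so that
   finite ones are included without padding by empty sets (which matters for
   [s = 0], since [0 `^ 0 = 1]). *)
Definition hausdorff_content s delta F : \bar R :=
  ereal_inf [set x | exists (D : set nat) (U : nat -> set (R * R)),
    [/\ F `<=` \bigcup_(i in D) U i,
        forall i, D i -> diameter (U i) <= delta%:E &
        x = \esum_(i in D) poweR (diameter (U i)) s]].

(* This limit, like the one in [packing_premeasure], exists in [\bar R] because
   the function is monotone in [delta]. *)
Definition hausdorff_measure s F : \bar R :=
  lim (hausdorff_content s delta F @[delta --> (0 : R)^'+]).

Definition hausdorff_dim F : \bar R :=
  ereal_inf [set s%:E | s in [set s | (0 <= s)%R /\ hausdorff_measure s F = 0]].

Definition packing_content s delta F : \bar R :=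
  ereal_sup [set x | exists (D : set nat) (c : nat -> R * R) (r : nat -> R),
    [/\ forall i, D i -> F (c i),
        forall i, D i -> (0 < r i <= delta)%R,
        trivIset D (fun i => closed_disc (c i) (r i)) &
        x = \esum_(i in D) poweR (diameter (closed_disc (c i) (r i))) s]].

Definition packing_premeasure s F : \bar R :=
  lim (packing_content s delta F @[delta --> (0 : R)^'+]).

Definition packing_measure s F : \bar R :=
  ereal_inf [set \sum_(0 <= i <oo) packing_premeasure s (E i) |
             E in [set E : nat -> set (R * R) | F `<=` \bigcup_i E i]].

Definition packing_dim F : \bar R :=
  ereal_inf [set s%:E | s in [set s | (0 <= s)%R /\ packing_measure s F = 0]].

(* For bounded [F] and [0 < delta] the infimum is over a nonempty set of
   naturals, hence a minimum. *)
Definition covering_number delta F : R :=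
  inf [set n%:R | n in [set n : nat | exists U : nat -> set (R * R),
    F `<=` \bigcup_(i in [set i | (i < n)%N]) U i /\
    forall i, (i < n)%N -> diameter (U i) <= delta%:E]].

Definition has_box_dim F (beta : R) : Prop :=
  (ln (covering_number delta F) / - ln delta)%R @[delta --> (0 : R)^'+] --> beta.

End dimensions.

Inductive dimension := HausdorffDim | PackingDim | BoxDim.

Definition has_dim (R : realType) (dim : dimension) (F : set (R * R))
    (beta : R) : Prop :=
  match dim with
  | HausdorffDim => hausdorff_dim F = beta%:E
  | PackingDim => packing_dim F = beta%:E
  | BoxDim => has_box_dim F beta
  end.

(* Main.v *)
Require Import Defs.
From HB Require Import structures.
From mathcomp Require Import all_boot all_order all_algebra.
From mathcomp Require Import all_classical all_reals all_analysis.
From mathcomp Require Import ring lra zify.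
Import Order.TTheory GRing.Theory Num.Theory.
Import numFieldNormedType.Exports.
Set Implicit Arguments.
Unset Strict Implicit.
Unset Printing Implicit Defensive.
Local Open Scope classical_set_scope.

(** A single family of functions serves the three dimensions at once. Suppose
    that a plane set [F] can be covered by [C * delta^(-beta)] sets of diameter
    [delta], and that for every [s < beta] it carries an outer measure [nu] with
    [0 < nu F] and [nu A <= C * (diam A)^s]. The covers bound the Hausdorff,
    packing and box dimensions from above by [beta], the measures bound them
    from below by every [s < beta] (the mass distribution principle), so all
    three equal [beta]; this is [has_dim_of_bounds].

    Both bounds hold for the graph of a self-affine staircase [G]. Start from
    the diagonal of the unit square and refine it repeatedly: at each step every
    column is cut in three, and the piece of path in it, which joins two
    opposite corners of a rectangle, is either kept straight, going through
    three rectangles of a third of the height, or folded into a zigzag which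
    runs up, down and up again over the full height. If [k n] of the first [n]
    steps are of the straight kind, the path consists after [n] steps of
    rectangles of width [3^-n] and height [3^-(k n)]. Therefore [G] oscillates
    by about [3^-(k n)] on an interval of length [3^-n] ([staircase_modulus]),
    and, because all the rows are visited equally often ([count_low]), its
    values are equidistributed there: the points of a column of width [3^-n]
    where [G] falls in an interval of length [rho] have measure at most
    [4 * rho * 3^(k n) * 3^-n] ([staircase_level]). When [k n] grows like
    [(2 - beta) * n], the former statement gives the covers and the latter the
    measure bound, [nu] being the image of Lebesgue measure on the graph.

    The two bounds survive if [G] is multiplied by a positive constant and a
    Lipschitz function is added to it, since the latter only moves points
    vertically by [O(delta)] over an interval of length [delta]. As Lipschitz
    functions are uniformly dense in the continuous ones
    ([lipschitz_approximation]), so are these perturbed staircases. *)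

(** * The refined lattice paths *)

(** [k n] is the number of height subdivisions among the first [n] refinements. *)
Definition unit_steps (k : nat -> nat) : Prop :=
  k 0 = 0 /\ forall n, k n <= k n.+1 <= (k n).+1.

(** The ordinate at abscissa [j / 3^n] of the path after [n] refinements, in
    units of [3^-(k n)]. An edge from [a] to [b] is refined into
    [3a, 2a+b, a+2b, 3b] when the height is subdivided, and into the zigzag
    [a, b, a, b] when it is not. Indexing by the grid points, which neighbouring
    columns share, makes continuity automatic. *)
Fixpoint height (k : nat -> nat) (n j : nat) : nat :=
  if n is m.+1 then
    let a := height k m (j %/ 3) in
    let b := height k m (j %/ 3).+1 in
    let e := j %% 3 in
    if k m < k n then a * (3 - e) + b * e else if odd e then b else a
  else j.

Definition low (k : nat -> nat) (n j : nat) : nat :=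
  minn (height k n j) (height k n j.+1).

Section lattice_path.
Variable k : nat -> nat.
Hypothesis k_steps : unit_steps k.

Lemma unit_steps_homo m n : m <= n -> k m <= k n.
Proof.
apply: (@homo_leq _ k leq) => [//|? ? ?|i]; first exact: leq_trans.
by have [_ /(_ i)/andP[]] := k_steps.
Qed.

Lemma unit_steps_le n : k n <= n.
Proof.
have [k0 kS] := k_steps; elim: n => [|n IH]; first by rewrite k0.
by have := kS n; lia.
Qed.

(** The recursion also holds for [e = 3], where it is read off the next
    column; hence both ends of a refined edge obey one formula. *)
Lemma heightS n i e : e <= 3 ->
  height k n.+1 (3 * i + e) =
  if k n < k n.+1 then height k n i * (3 - e) + height k n i.+1 * e
  else if odd e then height k n i.+1 else height k n i.
Proof.
move=> e3 /=.
have [e_lt3|] := ltnP e 3.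
  have -> : (3 * i + e) %/ 3 = i by lia.
  by have -> : (3 * i + e) %% 3 = e by lia.
move=> e_ge3; have -> : e = 3 by lia.
have -> : (3 * i + 3) %/ 3 = i.+1 by lia.
have -> : (3 * i + 3) %% 3 = 0 by lia.
by case: ifP => _ //=; lia.
Qed.

Lemma height_adj n j :
  height k n j.+1 = (height k n j).+1 \/ height k n j = (height k n j.+1).+1.
Proof.
elim: n j => [|n IH] j; first by left.
have e3 : j %% 3 < 3 by rewrite ltn_mod.
have -> : j = 3 * (j %/ 3) + j %% 3 by lia.
rewrite -addnS !heightS//; last by lia.
have := IH (j %/ 3); move: (height _ _ _) (height _ _ _) => a b ab.
by move: (j %% 3) e3 => [|[|[|]]]//= _; by case: ifP => _; lia.
Qed.

Lemma lowS n i e : e < 3 ->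
  low k n.+1 (3 * i + e) =
  if k n < k n.+1 then
    3 * low k n i + (if height k n i < height k n i.+1 then e else 2 - e)
  else low k n i.
Proof.
move=> e3; rewrite /low -addnS !heightS//; last by lia.
have := height_adj n i; move: (height _ _ _) (height _ _ _) => a b ab.
by move: e e3 => [|[|[|]]]//= _; case: ifP => _; try case: ifP; lia.
Qed.

Lemma low_adj n i j : i <= j <= i.+1 ->
  low k n i <= (low k n j).+1 /\ low k n j <= (low k n i).+1.
Proof.
move=> ij; have [->|->] : j = i \/ j = i.+1 by lia.
  by [].
rewrite /low; have := height_adj n i; have := height_adj n i.+1; lia.
Qed.

(** In the units of the plane: the rectangle of a refined column lies inside
    the rectangle of its parent, for the bottom and for the top side. *)
Lemma low_nested n i :
  3 ^ k n.+1 * low k n (i %/ 3) <= 3 ^ k n * low k n.+1 i /\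
  3 ^ k n * (low k n.+1 i).+1 <= 3 ^ k n.+1 * (low k n (i %/ 3)).+1.
Proof.
have e3 : i %% 3 < 3 by rewrite ltn_mod.
have -> : low k n.+1 i = low k n.+1 (3 * (i %/ 3) + i %% 3) by congr low; lia.
rewrite lowS//; have [_ /(_ n) kn] := k_steps.
have : 0 < 3 ^ k n by rewrite expn_gt0.
case: ifP => kS.
  have -> : k n.+1 = (k n).+1 by lia.
  rewrite expnS; case: ifP => _; move: (i %% 3) e3 => e ?; move: (3 ^ _) => p; nia.
have -> : k n.+1 = k n by lia.
by move=> _; split.
Qed.

Lemma sum_nat3 (F : nat -> nat) M :
  \sum_(0 <= j < 3 * M) F j =
  \sum_(0 <= i < M) (F (3 * i) + F (3 * i + 1) + F (3 * i + 2)).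
Proof.
elim: M => [|M IH]; first by rewrite muln0 !big_geq.
have -> : 3 * M.+1 = (3 * M).+3 by lia.
rewrite [RHS]big_nat_recr//= -IH !big_nat_recr//=.
by rewrite !addnA [(3 * M + 1)%N]addn1 [(3 * M + 2)%N]addn2.
Qed.

(** Inside column [i] of level [n] there are [3^m] columns of level [n + m], and
    [3^(k (n + m) - k n)] rows; no row is visited more often than average. A
    zigzag step triples the visits to a row, a straight step distributes
    the three refined columns over the three new rows. *)
Lemma count_low n m i (c : nat) :
  3 ^ k (n + m) *
    (\sum_(0 <= e < 3 ^ m) (low k (n + m) (3 ^ m * i + e) == c))
  <= 3 ^ (m + k n).
Proof.
elim: m c => [|m IH] c.
  rewrite !addn0 add0n big_nat1 -[leqRHS]muln1 leq_mul2l.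
  by case: (_ == c); rewrite orbT.
rewrite expnS sum_nat3.
have [_ /(_ (n + m)) kn] := k_steps.
have E j e : e < 3 -> low k (n + m.+1) (3 * 3 ^ m * i + (3 * j + e)) =
    if k (n + m) < k (n + m).+1 then
    3 * low k (n + m) (3 ^ m * i + j) +
      (if height k (n + m) (3 ^ m * i + j) < height k (n + m) (3 ^ m * i + j).+1
       then e else 2 - e)
    else low k (n + m) (3 ^ m * i + j).
  move=> e3; rewrite addnS -lowS//; congr low; lia.
have E0 j := E j 0 isT; have E1 j := E j 1 isT; have E2 j := E j 2 isT.
have [kS|kS] := ltnP (k (n + m)) (k (n + m).+1).
  have -> : k (n + m.+1) = (k (n + m)).+1 by rewrite addnS; lia.
  rewrite expnS -mulnA addSn expnS leq_mul2l/=.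
  apply: leq_trans (IH (c %/ 3)); rewrite leq_mul2l; apply/orP; right.
  apply: leq_sum => j _; have := E0 j; rewrite addn0 => ->.
  rewrite E1 E2 kS; by case: ifP => _; lia.
have -> : k (n + m.+1) = k (n + m) by rewrite addnS; lia.
rewrite addSn expnS; apply: leq_trans (leq_mul (leqnn 3) (IH c)).
rewrite mulnCA leq_mul2l; apply/orP; right.
rewrite big_distrr/=; apply: leq_sum => j _; have := E0 j; rewrite addn0 => ->.
by rewrite E1 E2 ltnNge kS/=; lia.
Qed.

Lemma count_low_range n m i v W :
  (3 ^ k (n + m) *
    (\sum_(0 <= e < 3 ^ m) (v <= low k (n + m) (3 ^ m * i + e) < v + W))
  <= W * 3 ^ (m + k n)).
Proof.
rewrite (_ : (\sum_(0 <= e < 3 ^ m) _) = (\sum_(0 <= w < W) \sum_(0 <= e < 3 ^ m)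
    (low k (n + m) (3 ^ m * i + e) == v + w))); last first.
  rewrite exchange_big/=; apply: eq_bigr => e _.
  move: (low _ _ _) => l; elim: W => [|W IH].
    by rewrite big_geq// addn0; case: ltngtP.
  by rewrite big_nat_recr//= -IH; case: eqP; lia.
rewrite big_distrr/= -{2}(subn0 W) -sum_nat_const_nat.
by apply: leq_sum => w _; exact: count_low.
Qed.

End lattice_path.

Local Open Scope ring_scope.

(** * Squares, discs and coverings in the plane *)

Section plane.
Context {R : realType}.
Implicit Types (p q c : R * R) (r : R) (A B F : set (R * R)).

Lemma euclid_dist_ge1 p q : `|p.1 - q.1| <= euclid_dist p q.
Proof. by rewrite -sqrtr_sqr ler_wsqrtr// lerDl sqr_ge0. Qed.

Lemma euclid_dist_ge2 p q : `|p.2 - q.2| <= euclid_dist p q.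
Proof. by rewrite -sqrtr_sqr ler_wsqrtr// lerDr sqr_ge0. Qed.

Lemma euclid_dist_le p q : euclid_dist p q <= `|p.1 - q.1| + `|p.2 - q.2|.
Proof.
rewrite -[leRHS]ger0_norm ?addr_ge0// -sqrtr_sqr ler_wsqrtr// [leRHS]sqrrD.
by rewrite !real_normK ?num_real// addrAC lerDl mulrn_wge0// mulr_ge0.
Qed.

Lemma diameter_ge0 A : (0 <= diameter A)%E.
Proof. by apply: ereal_sup_ubound; left. Qed.

Lemma diameter_ge A p q : A p -> A q -> ((euclid_dist p q)%:E <= diameter A)%E.
Proof. by move=> Ap Aq; apply: ereal_sup_ubound; right; exists p => //; exists q. Qed.

Lemma diameter_le A d : 0 <= d -> (forall p q, A p -> A q -> euclid_dist p q <= d) ->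
  (diameter A <= d%:E)%E.
Proof.
move=> d0 Ad; apply: ge_ereal_sup => _ [->|[p Ap [q Aq <-]]].
  by rewrite lee_fin.
by rewrite lee_fin Ad.
Qed.

(** A ball of the maximum distance: it replaces discs wherever the triangle
    inequality is needed, which is then applied coordinatewise. *)
Definition square (c : R * R) (r : R) : set (R * R) :=
  [set p | `|c.1 - p.1| <= r /\ `|c.2 - p.2| <= r].

Lemma diameter_square c r : 0 <= r -> (diameter (square c r) <= (4 * r)%:E)%E.
Proof.
move=> r0; apply: diameter_le; first by rewrite mulr_ge0.
move=> p q [p1 p2] [q1 q2]; apply: (le_trans (euclid_dist_le _ _)).
have /= := ler_distD c.1 p.1 q.1; have /= := ler_distD c.2 p.2 q.2.
rewrite [`|p.1 - c.1|]distrC [`|p.2 - c.2|]distrC; lra.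
Qed.

Lemma diameter_disc_ge c r : 0 <= r -> (r%:E <= diameter (closed_disc c r))%E.
Proof.
move=> r0; have Ac : closed_disc c r c.
  by rewrite /closed_disc/= /euclid_dist !subrr expr0n/= addr0 sqrtr0.
have Ad : closed_disc c r (c.1 + r, c.2).
  rewrite /closed_disc/= /euclid_dist/= subrr expr0n/= addr0 sqrtr_sqr.
  by rewrite opprD addrA subrr add0r normrN ger0_norm.
apply: (le_trans _ (diameter_ge Ac Ad)); rewrite lee_fin.
apply: (le_trans _ (euclid_dist_ge1 _ _)) => /=.
by rewrite opprD addrA subrr add0r normrN ger0_norm.
Qed.

Lemma le_diameter (A B : set (R * R)) : A `<=` B -> (diameter A <= diameter B)%E.
Proof.
move=> AB; apply: le_ereal_sup => _ [->|[p Ap [q Aq <-]]]; first by left.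
by right; exists p; [exact: AB|exists q => //; exact: AB].
Qed.

Lemma closed_disc_square c r : closed_disc c r `<=` square c r.
Proof.
by move=> p cp; split; [exact: le_trans (euclid_dist_ge1 _ _) cp|
  exact: le_trans (euclid_dist_ge2 _ _) cp].
Qed.

Lemma diameter_disc_le c r : 0 <= r ->
  (diameter (closed_disc c r) <= (4 * r)%:E)%E.
Proof.
move=> r0; apply: (le_trans _ (diameter_square c r0)).
exact/le_diameter/closed_disc_square.
Qed.

Lemma closed_disc_disjoint c c' r : ~ square c (2 * r) c' ->
  closed_disc c r `&` closed_disc c' r = set0.
Proof.
move=> cc'; rewrite -subset0 => p [/closed_disc_square[p1 p2]].
move=> /closed_disc_square[p1' p2']; apply: cc'; split.
  have /= := ler_distD p.1 c.1 c'.1; rewrite [`|p.1 - _|]distrC; lra.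
have /= := ler_distD p.2 c.2 c'.2; rewrite [`|p.2 - _|]distrC; lra.
Qed.

Definition coverable (N : nat) (delta : R) F : Prop :=
  exists U : nat -> set (R * R), F `<=` \bigcup_(i in [set i | (i < N)%N]) U i /\
    forall i, (i < N)%N -> (diameter (U i) <= delta%:E)%E.

(** Pigeonhole: a set of diameter at most [d] contains at most one point of a
    family whose points are more than [d] apart. *)
Lemma separated_coverable N d F n (c : 'I_n -> R * R) :
  coverable N d F -> (forall i, F (c i)) ->
  (forall i j, i != j -> d < euclid_dist (c i) (c j)) -> (n <= N)%N.
Proof.
move=> [U [FU dU]] Fc sep.
have /choice[u uP] : forall i, exists v : 'I_N, U v (c i).
  by move=> i; have [v vN Uv] := FU _ (Fc i); exists (Ordinal vN).
have uinj : injective u.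
  move=> i j uij; apply/eqP/negPn/negP => /sep; rewrite ltNge -lee_fin.
  rewrite (le_trans (diameter_ge (uP i) _) (dU _ (ltn_ord _)))//.
  by rewrite uij.
by have := leq_card u uinj; rewrite !card_ord.
Qed.

Lemma third_gt0 n : 0 < 3^-1 ^+ n :> R.
Proof. by rewrite exprn_gt0// invr_gt0. Qed.

Lemma third_le1 n : 3^-1 ^+ n <= 1 :> R.
Proof. by rewrite exprn_ile1 ?invr_ge0//; lra. Qed.

Lemma triadic_scale (r : R) : 0 < r <= 1 ->
  exists n, (3^-1 ^+ n.+1 < r <= 3^-1 ^+ n).
Proof.
move=> /andP[r0 r1].
have ex : exists m, 3^-1 ^+ m < r.
  exists (Num.truncn r^-1).+1; rewrite exprVn -[ltRHS]invrK ltf_pV2 ?posrE ?exprn_gt0 ?invr_gt0//.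
  apply: (lt_trans (truncnS_gt _)).
  by rewrite -natrX ltr_nat ltn_expl.
have [[|m] mr mmin] := ex_minnP ex.
  by rewrite expr0 ltNge r1 in mr.
exists m; rewrite mr/= leNgt; apply/negP => /mmin; by rewrite ltnn.
Qed.

Lemma small_powR (C t e delta : R) : 0 < C -> 0 < t -> 0 < e -> 0 < delta ->
  exists2 d, 0 < d <= 1 /\ d <= delta & C * d `^ t <= e.
Proof.
move=> C0 t0 e0 delta0; pose d0 := (e / C) `^ t^-1.
have d00 : 0 < d0 by rewrite powR_gt0// divr_gt0.
have m0 : 0 < Num.min 1 (Num.min delta d0) by rewrite !lt_min ltr01 delta0 d00.
exists (Num.min 1 (Num.min delta d0)).
  rewrite m0 ge_min lexx/=; split=> //.
  by rewrite ge_min ge_min lexx orbT.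
apply: (@le_trans _ _ (C * d0 `^ t)).
  rewrite ler_pM2l//; apply: ge0_ler_powR; rewrite ?nnegrE; try exact: ltW.
  by rewrite !ge_min lexx !orbT.
rewrite /d0 -powRrM mulVf ?gt_eqF// powRr1; last by rewrite divr_ge0// ltW.
by rewrite mulrCA divff ?gt_eqF// mulr1.
Qed.

End plane.

(** * Frostman bounds and Hausdorff measures from below *)

Lemma esum_scale_le (R : realType) (T : choiceType) (D : set T) (C : R)
    (a : T -> \bar R) : (0 <= C)%R -> (forall i, 0 <= a i)%E ->
  (\esum_(i in D) (C%:E * a i) <= C%:E * \esum_(i in D) a i)%E.
Proof.
move=> C0 a0; apply: ge_ereal_sup => _ [X DX <-].
rewrite -ge0_mule_fsumr//; apply: lee_wpmul2l; first by rewrite lee_fin.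
by apply: esum_ge; exists X.
Qed.

Lemma outer_measure_esum (R : realType) (T : Type) (mu : {outer_measure set T -> \bar R})
    (D : set nat) (U : nat -> set T) :
  (mu (\bigcup_(i in D) U i) <= \esum_(i in D) mu (U i))%E.
Proof.
rewrite bigcup_mkcond.
apply: (le_trans (outer_measure_sigma_subadditive mu _)).
rewrite nneseries_esumT; last by move=> n; exact: outer_measure_ge0.
rewrite [leRHS]esum_mkcond; apply: le_esum => i _.
by case: ifP => // _; rewrite outer_measure0.
Qed.

Section mass_distribution.
Context {R : realType} (nu : {outer_measure set (R * R) -> \bar R}).
Implicit Types (F : set (R * R)) (s b delta : R).
Local Open Scope ereal_scope.

Definition frostman s : Prop :=
  exists2 C : R, (0 < C)%R & forall A d, (0 < d <= 1)%R ->
    diameter A <= d%:E -> nu A <= (C * d `^ s)%:E.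

(** Extends the bound to sets of diameter zero. For [s > 0] these are null
    sets, by letting [d] tend to zero; for [s = 0] the convention [0 ^ 0 = 1]
    is what the bound requires. *)
Lemma frostman_poweR s : (0 <= s)%R -> frostman s ->
  exists2 C : R, (0 < C)%R &
    forall A, diameter A <= 1 -> nu A <= C%:E * poweR (diameter A) s.
Proof.
move=> s0 [C C0 Cfr]; exists C => // A A1.
have := diameter_ge0 A; case dA : (diameter A) (A1) => [d| |]//.
rewrite !lee_fin => d1; rewrite le_eqVlt => /predU1P[d0|d0]; last first.
  by rewrite poweR_EFin -EFinM Cfr ?d0 ?d1// dA.
rewrite -d0 poweR_EFin; move: s0; rewrite le_eqVlt => /predU1P[<-|s0].
  rewrite powRr0; have := Cfr A 1%R; rewrite powR1 EFinM; apply=> //.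
  by rewrite ltr01 lexx.
rewrite powR0 ?gt_eqF// mule0; apply/lee_addgt0Pr => e e0; rewrite add0e.
have [r [r01 _] re] := small_powR C0 s0 e0 ltr01.
apply: (@le_trans _ _ (C * r `^ s)%:E); last by rewrite lee_fin.
by apply: Cfr => //; rewrite dA lee_fin -d0; case/andP: r01 => /ltW.
Qed.

Lemma hausdorff_content_homo s F delta delta' : (delta <= delta')%R ->
  hausdorff_content s delta' F <= hausdorff_content s delta F.
Proof.
move=> dd'; apply: le_ereal_inf => _ [D [U [FU dU ->]]].
exists D, U; split => // i Di.
by apply: (le_trans (dU i Di)); rewrite lee_fin.
Qed.

(** The mass distribution principle: the pieces of a cover have total mass at
    least [nu F], and each has mass at most [C * (diam)^s]. *)
Lemma hausdorff_measure_gt0 s F : (0 <= s)%R -> frostman s -> 0 < nu F ->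
  0 < hausdorff_measure s F.
Proof.
move=> s0 /(frostman_poweR s0)[C C0 Cfr] nuF.
apply: (@lt_le_trans _ _ (C^-1%:E * nu F)).
  by rewrite mule_gt0// lte_fin invr_gt0.
apply: lime_ge.
  apply: nonincreasing_at_right_is_cvge; near=> x => d d' _ _.
  exact: hausdorff_content_homo.
near=> d; apply: le_ereal_inf_tmp => _ [D [U [FU dU ->]]].
rewrite muleC lee_pdivrMr// muleC.
apply: (@le_trans _ _ (\esum_(i in D) (nu (U i)))).
  apply: (le_trans (le_outer_measure nu _ _ FU)); exact: outer_measure_esum.
apply: le_trans (esum_scale_le _ (ltW C0) _); last by move=> i; exact: poweR_ge0.
apply: le_esum => i Di; apply: Cfr; apply: (le_trans (dU i Di)).
by rewrite lee_fin; near: d; apply: nbhs_right_le.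
Unshelve. all: by end_near. Qed.

End mass_distribution.

(** * Box counting bounds and Hausdorff measures from above *)

Section upper.
Context {R : realType}.
Implicit Types (F : set (R * R)) (s b delta : R).
Local Open Scope ereal_scope.

Definition box_counting_bound F b : Prop :=
  exists2 C : R, (0 < C)%R & forall delta, (0 < delta <= 1)%R ->
    exists2 N : nat, (N%:R <= C * delta `^ (- b))%R & coverable N delta F.

(** A cover by [C * d^(-b)] sets of diameter [d] has [s]-content at most
    [C * d^(s - b)], which tends to zero with [d]. *)
Lemma hausdorff_measure_eq0 s b F : (0 <= s)%R -> (b < s)%R -> box_counting_bound F b ->
  hausdorff_measure s F = 0.
Proof.
move=> s0 bs [C C0 CF]; have sb : (0 < s - b)%R by rewrite subr_gt0.
apply: lim_near_cst => //; near=> delta.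
have delta0 : (0 < delta)%R by near: delta; exact: nbhs_right_gt.
apply/eqP; rewrite eq_le; apply/andP; split; last first.
  by apply: le_ereal_inf_tmp => _ [D [U [_ _ ->]]]; apply: esum_ge0 => i _; exact: poweR_ge0.
apply/lee_addgt0Pr => e e0; rewrite add0e.
have [d [d01 ddelta] de] := small_powR C0 sb e0 delta0.
have [N NC [U [FU dU]]] := CF d d01; have /andP[d0 d1] := d01.
apply: (@le_trans _ _ (\esum_(i in [set i | (i < N)%N]) poweR (diameter (U i)) s)).
  apply: ereal_inf_lbound; exists [set i | (i < N)%N], U; split=> // i iN.
  by apply: (le_trans (dU i iN)); rewrite lee_fin.
rewrite esum_fset ?finite_II// => [|i _]; last exact: poweR_ge0.
rewrite -fsbig_ord.
apply: (@le_trans _ _ (\sum_(i < N) (d `^ s)%:E)).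
  apply: lee_sum => i _.
  rewrite -poweR_EFin; apply: gt0_ler_poweR => //; last exact: dU.
    by rewrite in_itv/= diameter_ge0 leey.
  by rewrite in_itv/= lee_fin ltW// leey.
rewrite sumEFin lee_fin sumr_const card_ord.
apply: le_trans de; rewrite -mulr_natl powRB// ?gt_eqF ?implybT// mulrA.
by rewrite [leRHS]mulrAC -powRN ler_wpM2r ?powR_ge0.
Unshelve. all: by end_near. Qed.

End upper.

(** * Packing measures from below *)

Section packing_premeasure.
Context {R : realType}.
Implicit Types (F : set (R * R)) (s delta : R).
Local Open Scope ereal_scope.

Lemma packing_content_homo s F delta delta' : (delta <= delta')%R ->
  packing_content s delta F <= packing_content s delta' F.
Proof.
move=> dd'; apply: le_ereal_sup => _ [D [c [r [Fc rd tr ->]]]].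
exists D, c, r; split => // i Di.
by have /andP[-> /le_trans->] := rd i Di.
Qed.

Lemma packing_content_ge0 s F delta : 0 <= packing_content s delta F.
Proof.
apply: ereal_sup_ubound; exists set0, (fun=> 0%R), (fun=> 0%R).
by rewrite esum_set0; split => // i j [].
Qed.

Lemma packing_premeasure_cvg s F :
  cvg (packing_content s delta F @[delta --> (0 : R)^'+]).
Proof.
apply: nondecreasing_at_right_is_cvge; near=> x => d d' _ _.
exact: packing_content_homo.
Unshelve. all: by end_near. Qed.

Lemma packing_premeasure_ge0 s F : 0 <= packing_premeasure s F.
Proof.
apply: lime_ge; first exact: packing_premeasure_cvg.
by apply: nearW => d; exact: packing_content_ge0.
Qed.

End packing_premeasure.

Section packing.
Context {R : realType}.
Implicit Types (E F : set (R * R)) (s b delta r : R).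

(** The size of a separated family is bounded by [separated_coverable], so
    there is a largest one, and a point far from all its members could be
    added to it. *)
Lemma maximal_separated E r N : 0 < r -> coverable N r E ->
  exists n (c : nat -> R * R), [/\ forall i, (i < n)%N -> E (c i),
    forall i j, (i < n)%N -> (j < n)%N -> i != j -> ~ square (c i) (2 * r) (c j) &
    forall p, E p -> exists2 i, (i < n)%N & square (c i) (2 * r) p].
Proof.
move=> r0 EN.
pose P n := `[< exists c : nat -> R * R, (forall i, (i < n)%N -> E (c i)) /\
  forall i j, (i < n)%N -> (j < n)%N -> i != j -> ~ square (c i) (2 * r) (c j) >].
have exP : exists n, P n by exists 0%N; apply/asboolP; exists (fun=> (0, 0)).
have bdP n : P n -> (n <= N)%N.
  move=> /asboolP[c [cE csep]].
  apply: (@separated_coverable _ N r E n (fun i : 'I_n => c i)) => //.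
    by move=> i; exact: cE.
  move=> i j ij; rewrite ltNge; apply/negP => cij.
  apply: (csep i j (ltn_ord i) (ltn_ord j) ij); split.
    by have := euclid_dist_ge1 (c i) (c j); lra.
  by have := euclid_dist_ge2 (c i) (c j); lra.
have [n /asboolP[c [cE csep]] nmax] := ex_maxnP exP bdP.
exists n, c; split => // p Ep; apply: contrapT => pfar.
have far i : (i < n)%N -> ~ square (c i) (2 * r) p by move=> ? ?; apply: pfar; exists i.
suff /nmax : P n.+1 by rewrite ltnn.
apply/asboolP; exists (fun i => if i == n then p else c i); split=> [i|i j].
  by rewrite ltnS; case: ltngtP => // iltn _; exact: cE.
rewrite !ltnS; case: (ltngtP i n) => [iltn|//|->] _; case: (ltngtP j n) => [jltn|//|_] _ // ij.
- exact: csep.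
- exact: far.
- by move=> [p1 p2]; apply: (far j jltn); rewrite /square/= distrC [X in _ /\ X <= _]distrC.
Qed.

Local Open Scope ereal_scope.

(** For each piece [E] of a decomposition, a maximal separated family in
    [E] gives disjoint discs of one radius [r] whose enlargements to squares cover
    [E]; comparing the mass of the squares with the discs yields
    [nu E <= C' * packing_premeasure s E], and outer measures are countably
    subadditive. *)
Lemma packing_measure_gt0 (nu : {outer_measure set (R * R) -> \bar R}) s F :
  (0 <= s)%R -> frostman nu s ->
  (forall r, (0 < r <= 1)%R -> exists N, coverable N r F) -> 0 < nu F ->
  0 < packing_measure s F.
Proof.
move=> s0 [C C0 Cfr] covF nuF; pose C' : R := (C * 8 `^ s)%R.
have C'0 : (0 < C')%R by rewrite mulr_gt0// powR_gt0.
have key E : nu (E `&` F) <= C'%:E * packing_premeasure s E.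
  rewrite -lee_pdivrMl//; apply: lime_ge; first exact: packing_premeasure_cvg.
  near=> d; have d0 : (0 < d)%R by near: d; exact: nbhs_right_gt.
  have d1 : (d <= 8^-1)%R by near: d; exact: nbhs_right_le.
  have [N NF] : exists N, coverable N d F by apply: covF; rewrite d0; lra.
  have EFN : coverable N d (E `&` F).
    by case: NF => U [FU dU]; exists U; split=> // p [_ /FU].
  have [n [c [cE csep cmax]]] := maximal_separated d0 EFN.
  rewrite lee_pdivrMl//.
  apply: (@le_trans _ _ (C'%:E *
      \esum_(i in `I_n) poweR (diameter (closed_disc (c i) d)) s)); last first.
    apply: lee_wpmul2l; first by rewrite lee_fin ltW.
    apply: ereal_sup_ubound; exists `I_n, c, (fun=> d); split=> //.
    - by move=> i /cE[].
    - by move=> i _; rewrite d0 lexx.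
    - apply/trivIsetP => i j iltn jltn ij; apply: closed_disc_disjoint.
      exact: csep.
  apply: (le_trans _ (esum_scale_le _ (ltW C'0) _)); last by move=> i; exact: poweR_ge0.
  apply: (@le_trans _ _ (nu (\bigcup_(i in `I_n) square (c i) (2 * d)))).
    by apply: le_outer_measure => p /cmax[i iltn cp]; exists i.
  apply: (le_trans (outer_measure_esum _ _ _)); apply: le_esum => i iltn.
  apply: (@le_trans _ _ (C * (8 * d) `^ s)%:E).
    apply: Cfr; first by rewrite mulr_gt0//=; lra.
    apply: (le_trans (diameter_square _ _)); first by rewrite mulr_ge0// ltW.
    by rewrite lee_fin; lra.
  rewrite powRM ?(ltW d0)// mulrA EFinM; rewrite -/C' lee_wpmul2l ?lee_fin ?(ltW C'0)//.
  rewrite -poweR_EFin; apply: gt0_ler_poweR => //.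
  - by rewrite in_itv/= lee_fin ltW// leey.
  - by rewrite in_itv/= diameter_ge0 leey.
  - by apply: diameter_disc_ge; exact: ltW.
apply: (@lt_le_trans _ _ (C'^-1%:E * nu F)).
  by rewrite mule_gt0// lte_fin invr_gt0.
apply: le_ereal_inf_tmp => _ [E FE <-]; rewrite lee_pdivrMl//.
rewrite nneseries_esumT; last by move=> n; exact: packing_premeasure_ge0.
apply: (le_trans _ (esum_scale_le _ (ltW C'0) _)); last first.
  by move=> i; exact: packing_premeasure_ge0.
apply: (@le_trans _ _ (nu (\bigcup_(i in setT) (E i `&` F)))).
  by apply: le_outer_measure => p Fp; have [i _ Eip] := FE p Fp; exists i.
apply: (le_trans (outer_measure_esum _ _ _)); apply: le_esum => i _; exact: key.
Unshelve. all: by end_near. Qed.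

End packing.

(** * Packing measures from above *)

Section packing_upper.
Context {R : realType}.
Implicit Types (E F : set (R * R)) (s b delta r : R).

Lemma geometric_tail_le (q : R) m M : 0 < q < 1 ->
  \sum_(m <= n < M) q ^+ n <= q ^+ m / (1 - q).
Proof.
move=> /andP[q0 q1]; have q1' : 0 < 1 - q by rewrite subr_gt0.
rewrite ler_pdivlMr//.
have [Mm|mM] := leqP M m; first by rewrite big_geq// mul0r exprn_ge0// ltW.
apply: (@le_trans _ _ (q ^+ m - q ^+ M)); last by rewrite gerBl exprn_ge0// ltW.
rewrite mulrC -(subnKC (ltnW mM)); elim: (M - m)%N => [|l IH].
  by rewrite addn0 big_geq// mulr0 subrr.
rewrite addnS big_nat_recr ?leq_addr//= mulrDr exprS; lra.
Qed.

Local Open Scope ereal_scope.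

(** Disjoint balls of radius more than [3^-(n+1)] have centres that far
    apart, hence their number is controlled by a cover at that scale. *)
Lemma count_separated_scale b C F (X : seq nat) (c : nat -> R * R) (r : nat -> R) n :
  (forall delta, (0 < delta <= 1)%R ->
    exists2 N : nat, (N%:R <= C * delta `^ (- b))%R & coverable N delta F) ->
  uniq X -> (forall i, i \in X -> F (c i)) ->
  (forall i j, i \in X -> j \in X -> i != j -> (r i < euclid_dist (c i) (c j))%R) ->
  ((count (fun i => 3^-1 ^+ n.+1 < r i) X)%:R <= C * (3^-1 ^+ n.+1) `^ (- b))%R.
Proof.
move=> CF uX Fc sep; rewrite -size_filter; set Y := seq.filter _ _.
have YX i : (i < size Y)%N -> (3^-1 ^+ n.+1 < r (nth 0%N Y i))%R /\ nth 0%N Y i \in X.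
  by move=> /(mem_nth 0%N); rewrite mem_filter => /andP[].
have [|N NC NF] := CF (3^-1 ^+ n.+1)%R.
  by rewrite third_gt0 third_le1.
apply: le_trans NC; rewrite ler_nat.
apply: (separated_coverable (c := fun i : 'I_(size Y) => c (nth 0%N Y i)) NF) => [i|i j ij].
  by apply: Fc; have [] := YX i (ltn_ord i).
have [ri iX] := YX i (ltn_ord i); have [rj jX] := YX j (ltn_ord j).
apply: (lt_trans ri); apply: sep => //.
by rewrite nth_uniq// filter_uniq.
Qed.

(** The balls of a packing are sorted by triadic scale. There are at most
    [C * 3^((n+1)b)] of them with radius about [3^-n], each contributing at most
    [(4 * 3^-n)^s], so the total is a geometric series of ratio [3^-(s-b)]. *)
Lemma packing_content_le s b F : (0 <= s)%R -> (b < s)%R -> box_counting_bound F b ->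
  exists2 K : R, (0 < K)%R &
    forall m, packing_content s (3^-1 ^+ m) F <= (K * (3^-1 ^+ m) `^ (s - b))%:E.
Proof.
move=> s0 bs [C C0 CF]; pose q : R := (3^-1 `^ (s - b))%R.
have q01 : (0 < q < 1)%R.
  rewrite powR_gt0 ?invr_gt0//=.
  have := @gt0_ltr_powR R (s - b)%R _ 3^-1%R 1%R; rewrite powR1 subr_gt0 => /(_ bs).
  by apply; rewrite ?nnegrE; lra.
have qE n : ((3^-1 ^+ n) `^ (s - b) = q ^+ n)%R.
  by rewrite -!powR_mulrn ?powR_ge0// /q -!powRrM mulrC.
have q1 : (0 < 1 - q)%R by rewrite subr_gt0; case/andP: q01.
pose K : R := (C * 4 `^ s * 3 `^ b)%R.
have K0 : (0 < K)%R by rewrite !mulr_gt0// powR_gt0.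
exists (K / (1 - q))%R; first exact: divr_gt0.
move=> m; rewrite qE; apply: ge_ereal_sup => _ [D [c [r [Fc rm tr ->]]]].
apply: ge_ereal_sup => _ [X [finX XD] <-].
have r0 i : D i -> (0 < r i)%R by move=> /rm/andP[].
have sep i j : D i -> D j -> i != j -> (r i < euclid_dist (c i) (c j))%R.
  move=> Di Dj ij; rewrite ltNge; apply/negP => cij.
  have /trivIsetP/(_ i j Di Dj ij) /= := tr.
  apply/eqP/set0P; exists (c j); split => //.
  rewrite /closed_disc/= /euclid_dist !subrr expr0n/= addr0 sqrtr0.
  by rewrite ltW// r0.
have /choice[sc scP] : forall i, exists n, D i ->
    (3^-1 ^+ n.+1 < r i <= 3^-1 ^+ n)%R /\ (m <= n)%N.
  move=> i; have [Di|nDi] := pselect (D i); last by exists 0%N.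
  have /andP[ri0 rim] := rm i Di.
  have [|n nP] := @triadic_scale R (r i).
    by rewrite ri0/= (le_trans rim)// third_le1.
  exists n => _; split=> //; rewrite leqNgt; apply/negP => nm.
  move: nP => /andP[+ _]; apply/negP; rewrite -leNgt (le_trans rim)//.
  by rewrite ler_wiXn2l ?invr_ge0//; lra.
pose s_ : seq nat := finmap.enum_fset (fset_set X).
have sD i : i \in s_ -> D i by rewrite in_fset_set// => /set_mem/XD.
pose M := (\max_(i <- s_) sc i).+1.
pose t n : R := ((4 * 3^-1 ^+ n) `^ s)%R.
rewrite fsbig_finite//=.
apply: (@le_trans _ _ (\sum_(i <- s_) (t (sc i))%:E)).
  rewrite big_seq [leRHS]big_seq; apply: lee_sum => i /sD Di.
  have [/andP[_ ri] _] := scP i Di; rewrite -poweR_EFin.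
  apply: gt0_ler_poweR => //.
  - by rewrite in_itv/= diameter_ge0 leey.
  - by rewrite in_itv/= lee_fin leey andbT mulr_ge0// ltW// third_gt0.
  - apply: (le_trans (diameter_disc_le _ (ltW (r0 i Di)))).
    by rewrite lee_fin ler_pM2l.
rewrite sumEFin lee_fin.
have -> : (\sum_(i <- s_) t (sc i) =
    \sum_(i <- s_) \sum_(m <= n < M) (if sc i == n then t n else 0))%R.
  rewrite big_seq [RHS]big_seq; apply: eq_bigr => i si.
  have [_ mi] := scP i (sD i si).
  rewrite (bigD1_seq (sc i)) ?iota_uniq//=; last first.
    by rewrite mem_index_iota mi ltnS /M; apply: leq_bigmax_seq.
  rewrite eqxx big1 ?addr0// => n; rewrite eq_sym; by case: eqP.
rewrite exchange_big/=.
apply: (@le_trans _ _ (\sum_(m <= n < M) K * q ^+ n)%R); last first.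
  by rewrite -mulr_sumr -mulrA (mulrC ((1 - q)^-1)%R) ler_pM2l//; exact: geometric_tail_le.
apply: ler_sum => n _; rewrite -big_mkcond/= big_const_seq iter_addr_0.
have cnt : ((count (fun i => sc i == n) s_)%:R <= C * (3^-1 ^+ n.+1) `^ (- b))%R.
  have := @count_separated_scale b C F s_ c r n CF (finmap.fset_uniq _).
  have Fs i : i \in s_ -> F (c i) by move=> /sD/Fc.
  have seps i j : i \in s_ -> j \in s_ -> i != j -> (r i < euclid_dist (c i) (c j))%R.
    by move=> /sD Di /sD Dj; exact: sep.
  move=> /(_ Fs seps); apply: le_trans; rewrite ler_nat.
  rewrite (@eq_in_count _ _ [pred i | (sc i == n) && (3^-1 ^+ n.+1 < r i)%R]).
    by apply: sub_count => i /andP[].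
  move=> i /sD Di /=; case: eqP => //= <-.
  by have [/andP[-> _] _] := scP i Di.
rewrite -mulr_natl; apply: (le_trans (ler_wpM2r (powR_ge0 _ _) cnt)).
rewrite -qE powRM ?(ltW (third_gt0 _))// powRB; last first.
  by rewrite gt_eqF ?implybT// third_gt0.
rewrite exprS powRM ?(ltW (third_gt0 _)) ?invr_ge0// !powRN.
have -> : ((3^-1 : R) `^ b = (3 `^ b)^-1)%R by rewrite -powR_inv1// -powRrM mulN1r powRN.
rewrite le_eqVlt; apply/orP; left; apply/eqP; rewrite invrK /K.
ring.
Qed.

Lemma packing_premeasure_eq0 s b F : (0 <= s)%R -> (b < s)%R -> box_counting_bound F b ->
  packing_premeasure s F = 0.
Proof.
move=> s0 bs Fb; have [K K0 KF] := packing_content_le s0 bs Fb.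
apply/eqP; rewrite eq_le packing_premeasure_ge0 andbT.
apply/lee_addgt0Pr => e e0; rewrite add0e.
have sb : (0 < s - b)%R by rewrite subr_gt0.
have [d [d01 _] de] := small_powR K0 sb e0 ltr01.
have [n /andP[nd _]] := triadic_scale d01.
apply: lime_le; first exact: packing_premeasure_cvg.
near=> x; apply: (@le_trans _ _ (packing_content s (3^-1 ^+ n.+1) F)).
  by apply: packing_content_homo; near: x; apply: nbhs_right_le; exact: third_gt0.
apply: (le_trans (KF _)); rewrite lee_fin; apply: le_trans de.
rewrite ler_pM2l//; apply: ge0_ler_powR; rewrite ?nnegrE; try exact: ltW.
by case/andP: d01 => /ltW.
Unshelve. all: by end_near. Qed.

Lemma packing_measure_eq0 s b F : (0 <= s)%R -> (b < s)%R -> box_counting_bound F b ->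
  packing_measure s F = 0.
Proof.
move=> s0 bs Fb; apply/eqP; rewrite eq_le; apply/andP; split.
  apply: ereal_inf_lbound; exists (fun=> F); first by move=> p Fp; exists 0%N.
  by rewrite eseries0// => i _ _; exact: packing_premeasure_eq0 Fb.
apply: le_ereal_inf_tmp => _ [E _ <-]; apply: nneseries_ge0 => i _ _.
exact: packing_premeasure_ge0.
Qed.

End packing_upper.

(** * All three dimensions from two bounds *)

Section dimension.
Context {R : realType}.
Implicit Types (E F : set (R * R)) (s b delta r : R).
Local Open Scope ereal_scope.

(** Hausdorff and packing dimensions are the same infimum formed with two
    different measures. *)
Lemma dim_of_measures (M : R -> \bar R) b : (0 <= b)%R ->
  (forall s, (b < s)%R -> M s = 0) ->
  (forall s, (0 <= s < b)%R -> M s <> 0) ->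
  ereal_inf [set s%:E | s in [set s | (0 <= s)%R /\ M s = 0]] = b%:E.
Proof.
move=> b0 Mgt Mlt; apply/eqP; rewrite eq_le; apply/andP; split.
  apply/lee_addgt0Pr => e e0; apply: ereal_inf_lbound; exists (b + e)%R => //.
  by split; [rewrite addr_ge0// ltW|apply: Mgt; rewrite ltrDl].
apply: le_ereal_inf_tmp => _ [s [s0 Ms] <-]; rewrite lee_fin leNgt.
by apply/negP => sb; apply: (Mlt s) => //; rewrite s0.
Qed.

Lemma covering_number_ge (nu : {outer_measure set (R * R) -> \bar R}) s F :
  frostman nu s -> 0 < nu F ->
  exists2 c : R, (0 < c)%R & forall N delta, (0 < delta <= 1)%R ->
    coverable N delta F -> (c * delta `^ (- s) <= N%:R)%R.
Proof.
move=> [C C0 Cfr] nuF.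
have [c c0 cF] : exists2 c : R, (0 < c)%R & c%:E <= nu F.
  case: (nu F) nuF => [c| |]//; first by rewrite lte_fin => c0; exists c.
  by move=> _; exists 1%R; rewrite ?leey.
exists (c / C)%R; first exact: divr_gt0.
move=> N d d01 [U [FU dU]]; have /andP[d0 d1] := d01.
rewrite powRN ler_pdivrMr ?powR_gt0// ler_pdivrMr// -lee_fin.
apply: (le_trans cF); apply: (le_trans (le_outer_measure nu _ _ FU)).
apply: (le_trans (outer_measure_esum _ _ _)).
rewrite esum_fset//.
rewrite -fsbig_ord; apply: (@le_trans _ _ (\sum_(i < N) (C * d `^ s)%:E)).
  by apply: lee_sum => i _; apply: Cfr => //; exact: dU.
by rewrite sumEFin lee_fin sumr_const card_ord -[leLHS]mulr_natl -mulrA (mulrC C).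
Qed.

(** Taking logarithms, the constants of both bounds are negligible with
    respect to [- ln delta]. *)
Lemma box_dim_of_bounds (nu : {outer_measure set (R * R) -> \bar R}) F b :
  (0 < b)%R -> box_counting_bound F b ->
  (forall s, (0 <= s < b)%R -> frostman nu s) -> 0 < nu F -> has_box_dim F b.
Proof.
move=> b0 [C C0 CF] nufr nuF; apply/cvgrPdist_le => e e0.
(* The lower bound may only be used at nonnegative exponents. *)
pose s := Num.max 0%R (b - e / 2)%R.
have sb : (0 <= s < b)%R by rewrite /s le_max lexx/= gt_max b0/= gtrBl divr_gt0.
have bs : (b - e / 2 <= s)%R by rewrite /s le_max lexx orbT.
have [c c0 cF] := covering_number_ge (nufr s sb) nuF.
near=> d.
have d0 : (0 < d)%R by near: d; exact: nbhs_right_gt.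
have d1 : (d < 1)%R by near: d; exact: nbhs_right_lt.
have d01 : (0 < d <= 1)%R by rewrite d0 ltW.
pose S : set R := [set n%:R | n in [set n | coverable n d F]]%R.
have infE : covering_number d F = inf S by [].
have [N NC NF] := CF d d01.
have lbS : lbound S (c * d `^ (- s))%R by move=> _ [n nF <-]; exact: cF.
have NumC : (covering_number d F <= C * d `^ (- b))%R.
  rewrite infE; apply: le_trans NC; apply: ge_inf; last by exists N.
  by exists (c * d `^ (- s))%R.
have Numc : (c * d `^ (- s) <= covering_number d F)%R.
  by rewrite infE; apply: lb_le_inf => //; exists N%:R; exists N.
have Num0 : (0 < covering_number d F)%R.
  by apply: lt_le_trans Numc; rewrite mulr_gt0// powR_gt0.
pose L := (- ln d)%R.
have L0 : (0 < L)%R by rewrite /L oppr_gt0 ln_lt0// d0.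
have lnd : (ln d <= - (2 * (`|ln C| + `|ln c|) / e))%R.
  near: d; have := @lnNy R => /cvgrNy_le; exact.
have LM : (`|ln C| + `|ln c| <= L * (e / 2))%R.
  have : (2 * (`|ln C| + `|ln c|) / e <= L)%R by rewrite /L; lra.
  rewrite ler_pdivrMr//; lra.
have up : (ln (covering_number d F) <= ln C + b * L)%R.
  apply: (@le_trans _ _ (ln (C * d `^ (- b)))).
    by rewrite ler_ln ?posrE// mulr_gt0// powR_gt0.
  by rewrite lnM ?posrE ?powR_gt0// ln_powR /L mulNr mulrN.
have lo : (ln c + s * L <= ln (covering_number d F))%R.
  apply: (@le_trans _ _ (ln (c * d `^ (- s)))).
    by rewrite lnM ?posrE ?powR_gt0// ln_powR /L mulNr mulrN.
  by rewrite ler_ln ?posrE// mulr_gt0// powR_gt0.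
rewrite -/L; set x := (_ / L)%R.
have xE : ln (covering_number d F) = (x * L)%R by rewrite /x divfK ?gt_eqF.
rewrite xE in up lo.
have := ler_norm (ln C); have := ler_norm (- ln c); rewrite normrN => h1 h2.
have h3 : ((b - s) * L <= e / 2 * L)%R by rewrite ler_pM2r//; lra.
have h4 := normr_ge0 (ln c); have h5 := normr_ge0 (ln C).
rewrite ler_norml -(ler_pM2r L0) -[X in _ && X](ler_pM2r L0); apply/andP; split; lra.
Unshelve. all: by end_near. Qed.

Lemma has_dim_of_bounds (nu : {outer_measure set (R * R) -> \bar R}) F b dim :
  (0 < b)%R -> box_counting_bound F b ->
  (forall s, (0 <= s < b)%R -> frostman nu s) -> 0 < nu F -> has_dim dim F b.
Proof.
move=> b0 Fb nufr nuF; case: dim => /=; last exact: box_dim_of_bounds nufr nuF.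
  apply: dim_of_measures => [|s bs|s sb]; first exact: ltW.
    by apply: (hausdorff_measure_eq0 _ bs Fb); exact: ltW (lt_trans b0 bs).
  have /andP[s0 _] := sb.
  by apply/eqP; rewrite gt_eqF// (hausdorff_measure_gt0 s0 (nufr s sb)).
apply: dim_of_measures => [|s bs|s sb]; first exact: ltW.
  by apply: (packing_measure_eq0 _ bs Fb); exact: ltW (lt_trans b0 bs).
have /andP[s0 _] := sb.
apply/eqP; rewrite gt_eqF// (packing_measure_gt0 s0 (nufr s sb))//.
by move=> r r01; have [C _ /(_ r r01)[N _ NF]] := Fb; exists N.
Qed.

End dimension.

(** * The staircase function *)

Section staircase.
Context {R : realType}.
Variable k : nat -> nat.
Hypothesis k_steps : unit_steps k.
Implicit Types (x y c rho : R).

Definition column (n : nat) x : nat := Num.truncn (3 ^+ n * x).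

(** The bottom of the rectangle of level [n] above [x]. These values increase with
    [n], as the rectangles are nested, and their supremum is the staircase. *)
Definition lower_approx n x : R := (low k n (column n x))%:R * 3^-1 ^+ k n.

Definition staircase x : R := sup (range (lower_approx ^~ x)).

Lemma column_div3 n x : (column n.+1 x %/ 3)%N = column n x.
Proof.
rewrite /column exprS -mulrA; move: (3 ^+ n * x) => y.
have [y0|y0] := ltP y 0.
  by rewrite !(truncn0Pn _ _) // -ltNge; lra.
have y30 : 0 <= 3 * y by rewrite mulr_ge0.
have /andP[lo up] := truncn_itv y30; apply/esym/truncn_def.
move: (Num.truncn _) lo up => m lo up.
have : (3 * (m %/ 3) <= m)%N by lia.
have : (m.+1 <= 3 * (m %/ 3).+1)%N by lia.
rewrite -!(ler_nat R) !natrM => h1 h2; apply/andP; split; lra.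
Qed.

Lemma column_divX n m x : (column (n + m) x %/ 3 ^ m)%N = column n x.
Proof.
elim: m => [|m IH]; first by rewrite addn0 divn1.
by rewrite addnS expnS divnMA column_div3.
Qed.

(** Valid on the whole line, as truncation sends negative numbers to [0]. *)
Lemma column_near n x y : `|x - y| <= 3^-1 ^+ n -> (column n x <= (column n y).+1)%N.
Proof.
move=> xy; rewrite truncn_le_nat.
apply: (@le_lt_trans _ _ (3 ^+ n * y + 1)).
  rewrite -lerBlDl -mulrBr -ler_pdivlMl ?exprn_gt0// mulr1 -exprVn.
  by apply: le_trans xy; exact: ler_norm.
by rewrite -[ltRHS]natr1 ltrD2r truncnS_gt.
Qed.

Lemma lower_approx_nested n x :
  lower_approx n x <= lower_approx n.+1 x /\
  lower_approx n.+1 x + 3^-1 ^+ k n.+1 <= lower_approx n x + 3^-1 ^+ k n.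
Proof.
have [] := low_nested k_steps n (column n.+1 x).
rewrite column_div3 /lower_approx !exprVn; move: (low _ _ _) (low _ _ _) => a b.
rewrite -!(ler_nat R) !natrM !natrX => h1 h2.
have p0 : 0 < 3 ^+ k n :> R by rewrite exprn_gt0.
have p1 : 0 < 3 ^+ k n.+1 :> R by rewrite exprn_gt0.
split.
  by rewrite ler_pdivlMr// mulrAC ler_pdivrMr// mulrC [leRHS]mulrC.
have E (u : R) v : u / v + v^-1 = (u + 1) / v by rewrite mulrDl mul1r.
rewrite !E !natr1.
by rewrite ler_pdivlMr// mulrAC ler_pdivrMr// mulrC [leRHS]mulrC.
Qed.

Lemma staircase_itv n x :
  lower_approx n x <= staircase x <= lower_approx n x + 3^-1 ^+ k n.
Proof.
have up m d : lower_approx m x <= lower_approx (m + d) x /\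
    lower_approx (m + d) x + 3^-1 ^+ k (m + d)%N <= lower_approx m x + 3^-1 ^+ k m.
  elim: d => [|d [IH1 IH2]]; first by rewrite addn0.
  have [h1 h2] := lower_approx_nested (m + d) x; rewrite addnS; split; lra.
have bd : ubound (range (lower_approx ^~ x)) (lower_approx n x + 3^-1 ^+ k n).
  move=> _ [m _ <-]; have [mn|nm] := leqP m n.
    have [h _] := up m (n - m)%N; rewrite subnKC// in h.
    by apply: (le_trans h); rewrite lerDl exprn_ge0 ?invr_ge0.
  have [_ h] := up n (m - n)%N; rewrite subnKC 1?ltnW// in h.
  by apply: le_trans h; rewrite lerDl exprn_ge0 ?invr_ge0.
apply/andP; split.
  by apply: ub_le_sup; [exists (lower_approx n x + 3^-1 ^+ k n)|exists n].
by apply: ge_sup => //; exists (lower_approx n x), n.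
Qed.

(** Points at distance at most [3^-n] lie in equal or adjacent columns, whose
    rectangles of height [3^-(k n)] touch. *)
Lemma staircase_modulus n x y : `|x - y| <= 3^-1 ^+ n ->
  `|staircase x - staircase y| <= 2 * 3^-1 ^+ k n.
Proof.
suff H u v : `|u - v| <= 3^-1 ^+ n -> staircase u - staircase v <= 2 * 3^-1 ^+ k n.
  move=> xy; rewrite ler_norml H ?andbT//.
  by have := @H y x; rewrite distrC => /(_ xy); lra.
move=> uv; have /andP[_ hu] := staircase_itv n u; have /andP[hv _] := staircase_itv n v.
have cuv := column_near uv; have cvu : (column n v <= (column n u).+1)%N.
  by apply: column_near; rewrite distrC.
have luv : (low k n (column n u) <= (low k n (column n v)).+1)%N.
  have [uv'|vu] := leqP (column n u) (column n v).
    by have [] := low_adj k n (i := column n u) (j := column n v); rewrite ?uv' ?cvu.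
  by have [] := low_adj k n (i := column n v) (j := column n u); rewrite ?(ltnW vu) ?cuv.
rewrite -(ler_nat R) -natr1 in luv.
have : lower_approx n u <= lower_approx n v + 3^-1 ^+ k n.
  by rewrite /lower_approx -[X in _ <= _ + X]mul1r -mulrDl ler_wpM2r//.
lra.
Qed.

End staircase.

(** * Equidistribution of the values of the staircase *)

(** Lebesgue outer measure, defined on all sets of reals: this dispenses with any
    measurability argument for the sets of a cover. *)
Definition outer_length {R : realType} (A : set R) : \bar R :=
  (wlength idfun)^*%mu (A : set (ocitv_type R)).

HB.instance Definition _ (R : realType) :=
  OuterMeasure.copy (@outer_length R)
    ((wlength idfun)^*%mu : set (ocitv_type R) -> \bar R).

Section outer_length.
Context {R : realType}.

Lemma outer_length_itv (a b : R) : a <= b -> outer_length `[a, b] = (b - a)%:E.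
Proof.
move=> ab; transitivity (lebesgue_measure `[a, b]%classic) => //.
rewrite lebesgue_measure_itv/= lte_fin -EFinB; case: ltP => // ba.
have -> : b = a by apply/eqP; rewrite eq_le ba.
by rewrite subrr.
Qed.

Variable k : nat -> nat.
Hypotheses (k_steps : unit_steps k) (k_oo : forall m, exists n, (m <= k n)%N).

(** At a level [N = n + m] so fine that its rectangles are lower than [rho], the
    set is covered by the columns of level [N] whose rectangles meet the strip;
    these occupy at most [3^(k N) * rho + 3] rows, and [count_low_range] bounds
    the number of visits to each of them. *)
Lemma staircase_level n j (c rho : R) : 0 < rho ->
  (outer_length [set x | [/\ 0 <= x, column n x = j & c <= staircase k x <= c + rho]]%R
   <= (4 * rho * 3 ^+ k n * 3^-1 ^+ n)%:E)%E.
Proof.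
move=> rho0.
have [m mrho] : exists m, 1 <= 3 ^+ k (n + m)%N * rho.
  have [N Nrho] := k_oo (Num.truncn rho^-1).+1.
  exists N; rewrite -ler_pdivrMr// div1r.
  apply: ltW; apply: (lt_le_trans (truncnS_gt _)).
  rewrite -natrX ler_nat; apply: (@leq_trans (k N)) => //.
  apply: (@leq_trans (3 ^ k N)); first by rewrite ltnW// ltn_expl.
  by rewrite leq_exp2l// (unit_steps_homo k_steps)// leq_addl.
set N := (n + m)%N; pose K : R := 3 ^+ k N.
have K0 : 0 < K by rewrite exprn_gt0.
rewrite -/N -/K in mrho.
(* The rows of level [N] that can meet the strip are [v], ..., [v + W - 1]. *)
pose v := Num.truncn (K * c - 1); pose W := (Num.truncn (K * rho + 2)).+1.
pose hit e := (v <= low k N (3 ^ m * j + e) < v + W)%N.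
pose cell (i : nat) : set R := `[i%:R * 3^-1 ^+ N, i.+1%:R * 3^-1 ^+ N]%classic.
pose V e := if hit e then cell (3 ^ m * j + e)%N else set0.
apply: (@le_trans _ _ (outer_length (\bigcup_(e in `I_(3 ^ m)) V e))).
  apply: le_outer_measure => x [x0 xj /andP[cx xc]].
  have colE : (column N x = 3 ^ m * j + column N x %% 3 ^ m)%N.
    by rewrite -xj -(@column_divX R n m) mulnC -divn_eq.
  exists (column N x %% 3 ^ m)%N; first by rewrite /= ltn_mod expn_gt0.
  rewrite /V /hit -colE; have /andP[lo up] := staircase_itv k_steps N x.
  move: lo up; rewrite /lower_approx; set l := low _ _ _ => lo up.
  have lK : l%:R * 3^-1 ^+ k N = l%:R / K by rewrite exprVn.
  rewrite lK in lo up; rewrite exprVn -/K in up.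
  have h1 : l%:R <= K * (c + rho).
    by rewrite mulrC -ler_pdivrMr//; exact: le_trans xc.
  have h2 : K * c <= l%:R + 1.
    rewrite mulrC -ler_pdivlMr// mulrDl mul1r; exact: le_trans up.
  have -> : (v <= l)%N.
    rewrite -(@natrK R l); apply: le_truncn; lra.
  have -> : (l < v + W)%N.
    rewrite -(ltr_nat R) natrD.
    have := truncnS_gt (K * c - 1); have := truncnS_gt (K * rho + 2).
    rewrite -/v -/W -(natr1 v) /=; lra.
  rewrite /= /cell/= in_itv/=; have y0 : 0 <= 3 ^+ N * x by rewrite mulr_ge0// exprn_ge0.
  have /andP[xlo xup] := truncn_itv y0.
  rewrite !exprVn ler_pdivrMr ?exprn_gt0// ler_pdivlMr ?exprn_gt0// mulrC xlo.
  exact: ltW.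
apply: (le_trans (outer_measure_esum _ _ _)).
rewrite esum_fset// -fsbig_ord.
apply: (@le_trans _ _ (\sum_(e < 3 ^ m) ((hit e)%:R * 3^-1 ^+ N)%:E)%E).
  apply: lee_sum => e _; rewrite /V; case: (hit e); last first.
    by rewrite outer_measure0 mul0r.
  rewrite -[leLHS]/(outer_length (cell _)) outer_length_itv ?ler_wpM2r ?exprn_ge0 ?invr_ge0 ?ler_nat//.
  by rewrite -mulrBl -natr1 addrAC subrr add0r.
rewrite sumEFin lee_fin -mulr_suml -natr_sum -(big_mkord predT (fun e => nat_of_bool (hit e))).
have := count_low_range k_steps n m j v W; rewrite -/N -(ler_nat R) !natrM !natrX -/K.
rewrite -/hit; set cnt := (X in X%:R) => hcnt.
have Wle : W%:R <= 4 * (K * rho).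
  have /andP[+ _] : (Num.truncn (K * rho + 2))%:R <= K * rho + 2 <
      (Num.truncn (K * rho + 2)).+1%:R by apply: truncn_itv; lra.
  rewrite /W -natr1; lra.
have {hcnt} : K * cnt%:R <= K * (4 * rho * 3 ^+ (m + k n)).
  apply: (le_trans hcnt); rewrite mulrA ler_wpM2r ?exprn_ge0//; lra.
rewrite ler_pM2l// => hcnt.
apply: (le_trans (ler_wpM2r _ hcnt)); first by rewrite exprn_ge0// invr_ge0.
rewrite le_eqVlt; apply/orP; left; apply/eqP.
have E : 3 ^+ m * 3^-1 ^+ m = 1 :> R by rewrite -exprMn mulfV// expr1n.
rewrite /N !exprD -[RHS]mulr1 -[X in _ = _ * X]E; ring.
Qed.

End outer_length.

(** * Graphs of Lipschitz functions plus a staircase *)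

Definition graphR {R : realType} (h : R -> R) : set (R * R) :=
  [set p | 0 <= p.1 <= 1 /\ p.2 = h p.1].

Definition graph_measure {R : realType} (h : R -> R) (A : set (R * R)) : \bar R :=
  outer_length [set x | 0 <= x <= 1 /\ A (x, h x)].

Section graph_measure.
Context {R : realType} (h : R -> R).
Local Notation nu := (graph_measure h).

Let nu0 : nu set0 = 0%E.
Proof. by rewrite /nu (_ : [set x | _] = set0) ?outer_measure0// -subset0 => x []. Qed.

Let nu_ge0 A : (0 <= nu A)%E.
Proof. exact: outer_measure_ge0. Qed.

Let le_nu : {homo nu : A B / A `<=` B >-> (A <= B)%E}.
Proof. by move=> A B AB; apply: le_outer_measure => x [x01 /AB]. Qed.

Let nu_sigma : sigma_subadditive nu.
Proof.
move=> F; apply: le_trans (outer_measure_sigma_subadditive _ _).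
by apply: le_outer_measure => x [x01 [i _ Fi]]; exists i.
Qed.

HB.instance Definition _ := isOuterMeasure.Build R (R * R)%type nu
  nu0 nu_ge0 le_nu nu_sigma.

Lemma graph_measure_graph : nu (graphR h) = 1%E.
Proof.
rewrite -[RHS](_ : outer_length `[(0:R), 1] = 1%E); last first.
  by rewrite outer_length_itv// subr0.
congr outer_length; apply/seteqP; split => x /=; rewrite in_itv/=.
  by case.
by move=> x01; split => //; split.
Qed.

End graph_measure.

Lemma neighbour_offset (u v : nat) : (u <= v.+1)%N -> (v <= u.+1)%N ->
  exists2 i, (i < 3)%N & u = (v + i).-1.
Proof. by move=> uv vu; exists (u.+1 - v)%N; lia. Qed.

Section perturbed_staircase.
Context {R : realType}.
Variables (k : nat -> nat) (p : R -> R) (L eps b : R).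
Hypotheses (k_steps : unit_steps k) (k_oo : forall m, exists n, (m <= k n)%N).
Hypotheses (L0 : 0 <= L) (eps0 : 0 < eps) (b0 : 0 <= b).
Hypothesis p_lip : forall x y, `|p x - p y| <= L * `|x - y|.

Let h x := p x + eps * staircase k x.

Let w0 n : 0 < 3^-1 ^+ n :> R.
Proof. exact: third_gt0. Qed.

(** As [k n <= n], the variation [L * 3^-n] of the Lipschitz function is
    absorbed by the height [3^-(k n)] of a rectangle. *)
Lemma perturbed_modulus n x y : `|x - y| <= 3^-1 ^+ n ->
  `|h x - h y| <= (L + 2 * eps) * 3^-1 ^+ k n.
Proof.
move=> xy; have := p_lip x y; have := staircase_modulus k_steps xy.
set g := staircase k x - staircase k y => gle ple.
have -> : h x - h y = (p x - p y) + eps * g by rewrite /h /g; ring.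
have wk : 3^-1 ^+ n <= 3^-1 ^+ k n :> R.
  by rewrite ler_wiXn2l ?invr_ge0// ?(unit_steps_le k_steps)//; lra.
apply: (le_trans (ler_normD _ _)); rewrite normrM (gtr0_norm eps0).
have : eps * `|g| <= eps * (2 * 3^-1 ^+ k n) by rewrite ler_pM2l.
have : L * `|x - y| <= L * 3^-1 ^+ k n by rewrite ler_wpM2l// (le_trans xy).
lra.
Qed.

(** Above each of the [3^n + 1] columns of width [w = 3^-n], the graph has height
    [O(3^-(k n))] and is covered by [O(3^-(k n) / w)] boxes of side [w]. *)
Lemma box_counting_bound_perturbed :
  (exists2 C : R, 0 < C & forall n, 3^-1 ^+ k n <= C * (3^-1 ^+ n) `^ (2 - b)) ->
  box_counting_bound (graphR h) b.
Proof.
move=> [C C0 kC]; pose B := 2 * (L + 2 * eps) + 1.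
have [L0' eps0'] : 0 <= L /\ 0 < eps by [].
have B0 : 0 < B by rewrite /B; lra.
(* The factor 9 accounts for passing from [d] to the triadic scale below
   [d / 2], which is at least [d / 9]. *)
exists (2 * B * C * 9 `^ b); first by rewrite !mulr_gt0// powR_gt0.
move=> d /[dup] d01 /andP[d0 d1].
have [n0 /andP[n0d dn0]] := triadic_scale d01.
pose n := n0.+2; pose w : R := 3^-1 ^+ n; have w_gt0 : 0 < w by exact: w0.
have W1 : 3 ^+ n * w = 1 by rewrite /w -exprMn mulfV// expr1n.
have wE : w = 9^-1 * 3^-1 ^+ n0.
  by rewrite /w /n !exprS; lra.
have w2d : 2 * w <= d by move: n0d; rewrite exprS wE; lra.
have wd : d / 9 <= w by rewrite wE; lra.
pose a : R := 3^-1 ^+ k n; have a0 : 0 < a by exact: w0.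
have wa : w <= a.
  by rewrite /w /a ler_wiXn2l ?invr_ge0// ?(unit_steps_le k_steps)//; lra.
pose A := (L + 2 * eps) * a; have A0 : 0 < A by rewrite /A mulr_gt0//; lra.
pose M := (Num.truncn (2 * A / w)).+1.
have A2w : 0 <= 2 * A / w by rewrite divr_ge0// ?ltW// mulr_gt0.
have MB : M%:R <= B * (a / w).
  have /andP[+ _] := truncn_itv A2w; rewrite /M -natr1.
  have : 1 <= a / w by rewrite ler_pdivlMr// mul1r.
  rewrite /B /A; lra.
exists ((3 ^ n).+1 * M)%N.
  rewrite natrM -natr1 natrX.
  have n3 : 1 <= 3 ^+ n :> R by rewrite exprn_ege1//; lra.
  apply: (@le_trans _ _ (2 * 3 ^+ n * (B * (a / w)))).
    apply: ler_pM => //; lra.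
  have -> : 3 ^+ n = w^-1 by apply: (mulIf (lt0r_neq0 w_gt0)); rewrite W1 mulVf ?gt_eqF.
  apply: (@le_trans _ _ (2 * B * C * w `^ (- b))).
    have -> : - b = (2 - b) - 2 by ring.
    rewrite powRB; last by apply/implyP => _; rewrite gt_eqF.
    rewrite (_ : w `^ 2 = w * w); last by rewrite -expr2 -powR_mulrn// ltW.
    have -> : 2 * w^-1 * (B * (a / w)) = 2 * B * (a * (w * w)^-1).
      by move: (a) (B) => ? ?; field; rewrite gt_eqF.
    rewrite -[leRHS]mulrA; apply: ler_wpM2l; first by rewrite mulr_ge0// ltW.
    rewrite [leRHS]mulrA; apply: ler_wpM2r; last exact: kC.
    by apply: ltW; rewrite invr_gt0 mulr_gt0.
  rewrite -[leRHS]mulrA ler_pM2l; last by rewrite !mulr_gt0.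
  rewrite !powRN -[X in X * _]invrK -invfM lef_pV2 ?posrE ?powR_gt0//; last first.
    by rewrite mulr_gt0 ?invr_gt0 ?powR_gt0.
  have -> : (9 `^ b)^-1 = 9^-1 `^ b :> R.
    by rewrite -powRN -powR_inv1// -powRrM mulN1r.
  rewrite -powRM ?invr_ge0 ?(ltW d0)//; apply: ge0_ler_powR; rewrite ?nnegrE//.
  - by rewrite mulr_ge0 ?invr_ge0// ltW.
  - exact: ltW.
  - by rewrite mulrC.
(* Box number [i] is box [i %% M] above column [i %/ M], counted upwards from
   the ordinate [y0]. *)
pose y0 j := h (j%:R * w) - A.
pose U i : set (R * R) := [set q | column n q.1 = (i %/ M)%N /\ 0 <= q.1 /\
  y0 (i %/ M)%N + (i %% M)%:R * w <= q.2 <= y0 (i %/ M)%N + (i %% M)%:R * w + w].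
have colP x : 0 <= x -> (column n x)%:R * w <= x < (column n x)%:R * w + w.
  move=> x0; have y0' : 0 <= 3 ^+ n * x by rewrite mulr_ge0// exprn_ge0.
  have xE : 3 ^+ n * x * w = x by rewrite mulrAC W1 mul1r.
  have /andP[h1 h2] := truncn_itv y0'.
  rewrite -(ler_pM2r w_gt0) xE in h1.
  rewrite -(ltr_pM2r w_gt0) xE -natr1 mulrDl mul1r in h2.
  by rewrite h1.
exists U; split=> [[x y] [/= /andP[x0 x1] ->]|i _]; last first.
  apply: (@le_trans _ _ (2 * w)%:E); last by rewrite lee_fin.
  apply: diameter_le; first by rewrite mulr_ge0// ltW.
  move=> q q' [qc [q0 qy]] [qc' [q0' qy']].
  apply: (le_trans (euclid_dist_le _ _)).
  have := colP _ q0; have := colP _ q0'; rewrite qc qc'.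
  move: qy qy' => /andP[? ?] /andP[? ?] /andP[? ?] /andP[? ?].
  have : `|q.1 - q'.1| <= w by rewrite ler_norml; apply/andP; split; lra.
  have : `|q.2 - q'.2| <= w by rewrite ler_norml; apply/andP; split; lra.
  lra.
have /andP[jx xj] := colP x x0; set j := column n x in jx xj *.
have hx : `|h x - h (j%:R * w)| <= A.
  by apply: perturbed_modulus; rewrite -/w ler_norml; apply/andP; split; lra.
move: hx; rewrite ler_norml => /andP[hx1 hx2].
pose t := (h x - y0 j) / w.
have t0 : 0 <= t by apply: divr_ge0; [rewrite /y0; lra|exact: ltW].
have tA : t <= 2 * A / w by rewrite ler_pM2r ?invr_gt0// /y0; lra.
have tM : (Num.truncn t < M)%N by rewrite ltnS le_truncn.
have M0 : (0 < M)%N by [].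
have iM : ((j * M + Num.truncn t) %/ M = j)%N by rewrite divnMDl// divn_small// addn0.
have im : ((j * M + Num.truncn t) %% M = Num.truncn t)%N by rewrite modnMDl modn_small.
exists (j * M + Num.truncn t)%N.
  rewrite /= mulSnr.
  have jn : (j <= 3 ^ n)%N.
    rewrite -(ler_nat R) natrX; have := truncn_le (3 ^+ n * x).
    rewrite mulr_ge0 ?exprn_ge0// => /idP; rewrite -/(column n x) -/j => /le_trans; apply.
    by rewrite ler_piMr// exprn_ge0.
  by rewrite (leq_trans (n := j * M + M))%N ?ltn_add2l// leq_add2r leq_mul2r jn orbT.
rewrite /U/= iM im; split=> //; split => //.
have /andP[lo up] := truncn_itv t0; rewrite -natr1 in up.
have tE : t * w = h x - y0 j by rewrite /t divfK// gt_eqF.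
have : (Num.truncn t)%:R * w <= t * w by rewrite ler_pM2r.
have : t * w <= ((Num.truncn t)%:R + 1) * w by rewrite ler_pM2r// ltW.
rewrite tE => *; apply/andP; split; lra.
Qed.

(** A set of diameter [d] that meets the graph lives over at most three columns
    of width comparable to [d]; over these, being in the set confines the staircase to
    an interval of length [O(d)], and [staircase_level] applies. *)
Lemma frostman_perturbed s : s <= 2 ->
  (exists2 C : R, 0 < C & forall n, (3^-1 ^+ n) `^ (2 - s) <= C * 3^-1 ^+ k n) ->
  frostman (graph_measure h) s.
Proof.
move=> s2 [C C0 kC].
have [B B0 BE] : exists2 B, 0 < B & B = (1 + L) / eps.
  by exists ((1 + L) / eps) => //; rewrite divr_gt0// ltr_pwDl.
exists (72 * B * C); first by rewrite !mulr_gt0.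
move=> A d /[dup] d01 /andP[d0 d1] Ad.
have [A0|[a [a01 Aa]]] : graph_measure h A = 0%E \/ exists a, 0 <= a <= 1 /\ A (a, h a).
  have [[a [a01 Aa]]|none] := pselect (exists a, 0 <= a <= 1 /\ A (a, h a)).
    by right; exists a.
  left; rewrite /graph_measure (_ : [set x | _] = set0) ?outer_measure0//.
  by rewrite -subset0 => x xA; apply: none; exists x.
  by rewrite -[leLHS]/(graph_measure h A) A0 lee_fin !mulr_ge0 ?powR_ge0// ltW.
have [n /andP[nd dn]] := triadic_scale d01.
pose rho := 2 * B * d; have rho0 : 0 < rho by rewrite !mulr_gt0.
(* The predecessor is taken so that [i < 3] enumerates the column of [a] and
   its two neighbours. *)
pose V i := [set x | [/\ 0 <= x, column n x = (column n a + i).-1 &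
  staircase k a - B * d <= staircase k x <= staircase k a - B * d + rho]].
apply: (@le_trans _ _ (outer_length (\bigcup_(i in `I_3) V i))).
  apply: le_outer_measure => x [/andP[x0 x1] Ax].
  have xa : euclid_dist (x, h x) (a, h a) <= d.
    by rewrite -lee_fin; apply: le_trans Ad; exact: diameter_ge.
  have xa1 : `|x - a| <= d by exact: le_trans (euclid_dist_ge1 _ _) xa.
  have xa2 : `|h x - h a| <= d by exact: le_trans (euclid_dist_ge2 _ _) xa.
  have c1 : (column n x <= (column n a).+1)%N by apply: column_near; exact: le_trans dn.
  have c2 : (column n a <= (column n x).+1)%N.
    by apply: column_near; rewrite distrC; exact: le_trans dn.
  have [i i3 ci] := neighbour_offset c1 c2; exists i => //.
  have g : `|staircase k x - staircase k a| <= B * d.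
    rewrite BE mulrAC ler_pdivlMr// mulrC -[X in X * _](gtr0_norm eps0) -normrM.
    have -> : eps * (staircase k x - staircase k a) = (h x - h a) - (p x - p a).
      by rewrite /h; ring.
    apply: (le_trans (ler_normB _ _)); have := p_lip x a.
    have : L * `|x - a| <= L * d by rewrite ler_wpM2l.
    lra.
  move: g; rewrite ler_norml => /andP[g1 g2]; split => //.
  rewrite /rho; apply/andP; split; lra.
apply: (le_trans (outer_measure_esum _ _ _)); rewrite esum_fset// -fsbig_ord.
apply: (@le_trans _ _ (\sum_(i < 3) (4 * rho * 3 ^+ k n * 3^-1 ^+ n)%:E)%E).
  by apply: lee_sum => i _; exact: staircase_level.
rewrite sumEFin lee_fin sumr_const card_ord -[leLHS]mulr_natl.
have K0 : 0 < 3 ^+ k n :> R by rewrite exprn_gt0.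
have w3 : 3^-1 ^+ n <= 3 * d by move: nd; rewrite exprS; lra.
have kd : 3 ^+ k n * d `^ (2 - s) <= C.
  have := kC n; rewrite [3^-1 ^+ k n]exprVn ler_pdivlMr// mulrC; apply: le_trans.
  rewrite ler_pM2l//; apply: ge0_ler_powR; rewrite ?nnegrE ?subr_ge0//.
  exact: ltW.
have dd : d * d = d `^ (2 - s) * d `^ s.
  rewrite -powRD; last by apply/implyP => _; rewrite gt_eqF.
  by rewrite subrK -expr2 -powR_mulrn// ltW.
apply: (@le_trans _ _ (3 * (4 * rho * 3 ^+ k n * (3 * d)))).
  by rewrite !ler_pM2l// !mulr_gt0.
have -> : 3 * (4 * rho * 3 ^+ k n * (3 * d)) = 72 * B * (3 ^+ k n * (d * d)).
  by rewrite /rho; ring.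
rewrite dd mulrA -[leRHS]mulrA -[leLHS]mulrA ler_pM2l ?mulr_gt0//.
by rewrite mulrA ler_wpM2r ?powR_ge0.
Qed.

End perturbed_staircase.

(** * Exponent sequences with a prescribed slope *)

Section exponents.
Context {R : realType}.
Variable alpha : R.
Hypotheses (alpha0 : 0 <= alpha) (alpha1 : alpha <= 1).

(** The slope is [alpha]; the logarithm makes the sequence unbounded, hence
    the staircase continuous, even for [alpha = 0]. *)
Definition exponents (n : nat) : nat :=
  maxn (Num.truncn (alpha * n%:R)) (trunc_log 2 n.+1).

Lemma exponents_unit_steps : unit_steps exponents.
Proof.
split=> [|n]; first by rewrite /exponents mulr0 truncn0.
have h1 : (Num.truncn (alpha * n%:R) <= Num.truncn (alpha * n.+1%:R))%N.
  by rewrite le_truncn// ler_wpM2l// ler_nat.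
have h2 : (Num.truncn (alpha * n.+1%:R) <= (Num.truncn (alpha * n%:R)).+1)%N.
  rewrite truncn_le_nat -(natr1 n) mulrDr mulr1 -natr1.
  by have := truncnS_gt (alpha * n%:R); have := alpha1; lra.
have h3 : (trunc_log 2 n.+1 <= trunc_log 2 n.+2)%N by exact: leq_trunc_log.
have h4 : (trunc_log 2 n.+2 <= (trunc_log 2 n.+1).+1)%N.
  rewrite -trunc_log2_double//; apply: leq_trunc_log; lia.
by rewrite /exponents; lia.
Qed.

Lemma exponents_unbounded m : exists n, (m <= exponents n)%N.
Proof.
exists (2 ^ m)%N; rewrite /exponents leq_max; apply/orP; right.
by apply: trunc_log_max => //; rewrite leqW.
Qed.

Lemma exponents_lower n : 3^-1 ^+ exponents n <= 3 * (3^-1 ^+ n) `^ alpha :> R.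
Proof.
have h : alpha * n%:R <= (exponents n).+1%:R.
  apply: ltW; apply: (lt_le_trans (truncnS_gt _)).
  by rewrite ler_nat ltnS /exponents leq_maxl.
have third1 : 0 < (3^-1 : R) <= 1 by apply/andP; split; lra.
have : 3^-1 ^+ (exponents n).+1 <= (3^-1 ^+ n) `^ alpha :> R.
  rewrite -!powR_mulrn ?invr_ge0// -powRrM mulrC.
  exact: ger_powR.
rewrite exprS; lra.
Qed.

(** The floor obeys the bound with [C = 1]. For the logarithm,
    [3^(trunc_log 2 n.+1) <= (n+1)^2], and [(n+1) * z^n] is at most the geometric
    sum of the powers of [z], hence bounded when [z < 1]. *)
Lemma exponents_upper t : alpha < t ->
  exists2 C : R, 0 < C & forall n, (3^-1 ^+ n) `^ t <= C * 3^-1 ^+ exponents n.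
Proof.
move=> at_; have t0 : 0 < t by exact: le_lt_trans at_.
have third1 : 0 < (3^-1 : R) <= 1 by apply/andP; split; lra.
have zz : 3^-1 `^ (t / 2) * 3^-1 `^ (t / 2) = 3^-1 `^ t :> R.
  rewrite -powRD; last by apply/implyP => _; rewrite gt_eqF; case/andP: third1.
  by congr (_ `^ _); lra.
have z01 : 0 < (3^-1 `^ (t / 2) : R) < 1.
  rewrite powR_gt0 ?invr_gt0//=.
  have := @gt0_ltr_powR R (t / 2) _ 3^-1 1; rewrite powR1 divr_gt0// => /(_ isT).
  by apply; rewrite ?nnegrE; lra.
move: (3^-1 `^ (t / 2)) z01 zz => z z01 zz.
have /andP[z0 z1] := z01; have z1' : 0 < 1 - z by rewrite subr_gt0.
have [D D1 DE] : exists2 D, 1 <= D & D = (1 - z)^-1.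
  by exists (1 - z)^-1 => //; rewrite -invr1 lef_pV2 ?posrE//; lra.
have zn n : n.+1%:R * z ^+ n <= D.
  apply: (@le_trans _ _ (\sum_(0 <= i < n.+1) z ^+ i)); last first.
    by rewrite DE -[leRHS]mul1r -(expr0 z); exact: geometric_tail_le.
  rewrite mulr_natl -{1}(subn0 n.+1) -sumr_const_nat big_nat_cond [leRHS]big_nat_cond.
  apply: ler_sum => i /andP[/andP[_ ilen] _].
  by rewrite ler_wiXn2l// ltW.
have D0 : 0 < D by exact: lt_le_trans D1.
exists (D * D); first by rewrite mulr_gt0.
move=> n; have DD1 : 1 <= D * D by rewrite mulr_ege1.
have tE : (3^-1 ^+ n) `^ t = (z ^+ n) * (z ^+ n).
  rewrite -exprMn zz -!powR_mulrn ?powR_ge0 ?invr_ge0// -!powRrM.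
  by rewrite mulrC.
have [e|e] : exponents n = Num.truncn (alpha * n%:R) \/
    exponents n = trunc_log 2 n.+1 by rewrite /exponents; lia.
  apply: (@le_trans _ _ (3^-1 ^+ exponents n)); last first.
    by rewrite -[leLHS]mul1r ler_wpM2r// ltW// third_gt0.
  rewrite -!powR_mulrn ?invr_ge0// -powRrM; apply: ger_powR => //.
  have an0 : 0 <= alpha * n%:R by rewrite mulr_ge0.
  rewrite e; have /andP[h _] := truncn_itv an0; apply: (le_trans h).
  by rewrite mulrC ler_wpM2l// ltW.
have n0 : 0 < n.+1%:R :> R by [].
have h : 3 ^+ exponents n <= n.+1%:R * n.+1%:R :> R.
  rewrite -natrX -natrM ler_nat e.
  have h2 := trunc_logP (isT : 1 < 2)%N (isT : 0 < n.+1)%N.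
  apply: leq_trans (leq_mul h2 h2); rewrite -expnMn.
  by case: (trunc_log 2 n.+1) => // l; rewrite leq_exp2r.
rewrite tE exprVn ler_pdivlMr ?exprn_gt0//.
apply: (@le_trans _ _ ((z ^+ n * z ^+ n) * (n.+1%:R * n.+1%:R))).
  by rewrite ler_wpM2l// mulr_ge0// exprn_ge0// ltW.
have -> : z ^+ n * z ^+ n * (n.+1%:R * n.+1%:R) =
  (n.+1%:R * z ^+ n) * (n.+1%:R * z ^+ n) by ring.
by apply: ler_pM => //; rewrite mulr_ge0// exprn_ge0// ltW.
Qed.

End exponents.

(** * Lipschitz approximation and density *)

Section approximation.
Context {R : realType}.
Implicit Types (g : R -> R) (e : R).

(** Heine-Cantor, by covering the interval with the neighbourhoods given by
    continuity. *)
Lemma uniform_continuity01 g e : {within `[0, 1], continuous g} -> 0 < e ->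
  exists2 d, 0 < d & forall x y, x \in `[0, 1] -> y \in `[0, 1] ->
    `|x - y| < d -> `|g x - g y| < e.
Proof.
move=> /subspace_continuousP cg e0.
have /compact_near_coveringP/(_ R (0^'+) (fun d x => forall y, `[0, 1]%classic x ->
    `[0, 1]%classic y -> `|x - y| < d -> `|g x - g y| < e)) := @segment_compact R 0 1.
have F : Filter (0 : R)^'+ by exact: at_right_proper_filter.
move=> /(_ F)[].
  move=> x x01; have := cg x x01; have e20 : 0 < e / 2 by rewrite divr_gt0.
  move=> /cvgrPdist_lt/(_ _ e20).
  rewrite near_withinE => /nbhs_ballP[eta /= eta0 xeta].
  near=> x' d.
  have xx' : `|x - x'| < eta / 2.
    by near: x'; apply/nbhs_ballP; exists (eta / 2) => //=; rewrite divr_gt0.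
  have deta : d < eta / 2 by near: d; apply: nbhs_right_lt; rewrite divr_gt0.
  move=> y x'01 y01 x'y; have x'y' := lt_trans x'y deta.
  have xy : `|x - y| < eta by have := ler_distD x' x y; lra.
  have gx' : `|g x - g x'| < e / 2 by apply: xeta => //=; rewrite /ball/=; lra.
  have gy : `|g x - g y| < e / 2 by exact: xeta.
  have := ler_distD (g x) (g x') (g y); rewrite (distrC (g x') (g x)); lra.
move=> d /= d0 dP; exists (d / 2); first by rewrite divr_gt0.
move=> x y x01 y01 xy.
have := dP (d / 2) _ _ x _ y x01 y01 xy; apply => //=.
  by rewrite sub0r normrN gtr0_norm ?divr_gt0//; lra.
by rewrite divr_gt0.
Unshelve. all: by end_near. Qed.

(** The Lipschitz envelope [inf_y (g y + K * |x - y|)]: for [K = 2M / d] with [M]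
    a bound for [g], points [y] farther than [d] from [x] cannot beat [g x],
    and closer ones do so by at most [e]. *)
Lemma lipschitz_approximation g e : {within `[0, 1], continuous g} -> 0 < e ->
  exists p : R -> R, exists2 L, 0 <= L &
    (forall x y, `|p x - p y| <= L * `|x - y|) /\
    (forall x, x \in `[0, 1] -> `|p x - g x| <= e).
Proof.
move=> cg e0; have [d d0 gd] := uniform_continuity01 cg e0.
have [M M0 gM] : exists2 M, 0 <= M & forall x, x \in `[0, 1] -> `|g x| <= M.
  have [c _ cmax] := EVT_max ler01 cg; have [c' _ cmin] := EVT_min ler01 cg.
  exists (`|g c| + `|g c'|) => [|x x01]; first by rewrite addr_ge0.
  have := cmax x x01; have := cmin x x01; have := ler_norm (g c).
  have := ler_norm (- g c'); rewrite normrN; have := normr_ge0 (g c).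
  have := normr_ge0 (g c'); rewrite ler_norml => *; apply/andP; split; lra.
pose K := 2 * M / d; have K0 : 0 <= K by rewrite /K divr_ge0 ?(ltW d0)// mulr_ge0.
pose S x : set R := [set g y + K * `|x - y| | y in `[0, 1]%classic].
have SM x : lbound (S x) (- M).
  move=> _ [y y01 <-]; have := gM y y01; rewrite ler_norml => /andP[h _].
  by apply: (le_trans h); rewrite lerDl mulr_ge0.
have S0 x : S x !=set0.
  by exists (g 0 + K * `|x - 0|), 0 => //; rewrite /= in_itv/= lexx ler01.
pose p x := inf (S x).
have plip x y : p x - p y <= K * `|x - y|.
  rewrite lerBlDr -lerBlDl; apply: lb_le_inf => // _ [z z01 <-].
  rewrite lerBlDl; apply: (@le_trans _ _ (g z + K * `|x - z|)).
    by apply: ge_inf; [exists (- M)|exists z].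
  have : K * `|x - z| <= K * (`|x - y| + `|y - z|).
    by rewrite ler_wpM2l// ler_distD.
  lra.
exists p, K => //; split => [x y|x x01].
  by rewrite ler_norml plip andbT; have := plip y x; rewrite distrC; lra.
have up : p x <= g x.
  by apply: ge_inf; [exists (- M)|exists x => //; rewrite subrr normr0 mulr0 addr0].
have lo : g x - e <= p x.
  apply: lb_le_inf => // _ [y y01 <-].
  have [xy|xy] := ltP `|x - y| d.
    have := gd x y x01 y01 xy; rewrite ltr_norml => /andP[_ h].
    have : 0 <= K * `|x - y| by rewrite mulr_ge0.
    lra.
  have : K * d <= K * `|x - y| by rewrite ler_wpM2l.
  rewrite /K divfK ?gt_eqF//.
  have := gM y y01; rewrite ler_norml => /andP[h _].
  have := gM x x01; rewrite ler_norml => /andP[_ h'].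
  lra.
rewrite ler_norml; apply/andP; split; lra.
Qed.

End approximation.

Section perturbed_graph.
Context {R : realType}.

Lemma perturbed_continuous (k : nat -> nat) (p : R -> R) (L eps : R) :
  unit_steps k -> (forall m, exists n, (m <= k n)%N) -> 0 <= L -> 0 < eps ->
  (forall x y, `|p x - p y| <= L * `|x - y|) ->
  continuous (fun x => p x + eps * staircase k x).
Proof.
move=> k_steps k_oo L0 eps0 plip x; apply/cvgrPdist_le => e e0.
pose B := L + 2 * eps; have B0 : 0 < B by rewrite /B; lra.
have [d [d01 _] de] := small_powR B0 ltr01 e0 ltr01.
have [m /andP[md _]] := triadic_scale d01.
have [n mn] := k_oo m.+1.
apply/nbhs_ballP; exists (3^-1 ^+ n) => /=; first exact: third_gt0.
move=> y xy; apply: (le_trans (perturbed_modulus k_steps L0 eps0 plip (ltW xy))).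
apply: le_trans de; rewrite powRr1 ?ler_pM2l//; last by case/andP: d01 => /ltW.
apply: ltW; apply: le_lt_trans md.
by rewrite ler_wiXn2l ?invr_ge0//; lra.
Qed.

Lemma staircase01 (k : nat -> nat) (x : R) : unit_steps k -> 0 <= x <= 1 ->
  0 <= staircase k x <= 2.
Proof.
move=> k_steps /andP[x0 x1]; have [k0 _] := k_steps.
have /andP[lo up] := staircase_itv k_steps 0 x.
have l1 : (low k 0 (column 0 x))%:R <= 1 :> R.
  rewrite lern1 /low /column expr0 mul1r.
  apply: (leq_trans (geq_minl _ _)) => /=.
  by rewrite truncn_le_nat; lra.
move: lo up; rewrite /lower_approx k0 expr0 mulr1 => lo up.
by apply/andP; split; [apply: le_trans lo|lra].
Qed.

(** With the exponents attached to [2 - beta] the covers have the exact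
    exponent [beta], while the mass bound is obtained for every [s < beta];
    that is enough, as a dimension not less than each such [s] is at least
    [beta]. *)
Lemma perturbed_has_dim (dim : dimension) (beta eps L : R) (p : R -> R) :
  1 <= beta <= 2 -> 0 < eps -> 0 <= L ->
  (forall x y, `|p x - p y| <= L * `|x - y|) ->
  has_dim dim (graphR (fun x => p x + eps * staircase (exponents (2 - beta)) x)) beta.
Proof.
move=> /andP[b1 b2] eps0 L0 plip.
have alpha0 : 0 <= 2 - beta by lra.
have alpha1 : 2 - beta <= 1 by lra.
have k_steps := exponents_unit_steps alpha0 alpha1.
set h := fun x => _.
apply: (@has_dim_of_bounds R (graph_measure h)).
- exact: lt_le_trans b1.
- apply: (box_counting_bound_perturbed k_steps L0 eps0 _ plip); first exact: le_trans b1.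
  by exists 3 => // n; exact: exponents_lower.
- move=> s /andP[s0 sb].
  have k_oo := exponents_unbounded (2 - beta).
  apply: (frostman_perturbed k_steps k_oo L0 eps0 plip); first by lra.
  by apply: exponents_upper => //; lra.
- by rewrite -[ltRHS]/(graph_measure h (graphR h)) graph_measure_graph.
Qed.

Lemma graph01_restriction (h : R -> R) (f : C01 R) :
  (forall x, f x = h (set_val x)) -> graph01 f = graphR h.
Proof.
move=> fh; apply/seteqP; split => [_ [u _ <-]|[x y] [/= x01 ->]].
  by split => //=; have := set_valP u; rewrite /= in_itv.
have x01' : x \in `[0, 1 : R]%classic by apply/mem_set; rewrite /= in_itv.
by exists (exist _ x x01') => //; rewrite fh.
Qed.

End perturbed_graph.

Theorem theorem3p3 (R : realType) (dim : dimension) (beta : R) :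
  1 <= beta <= 2 -> dense [set f : C01 R | has_dim dim (graph01 f) beta].
Proof.
move=> b12 O [f0 Of0] oO; have /andP[b1 b2] := b12.
have /nbhs_ballP[r /= r0 rO] : nbhs f0 O by exact: open_nbhs_nbhs.
have c0 : {within `[0, 1 : R], continuous (valL_ (0 : R) f0)}.
  by apply/subspace_valL_continuousP'; exact: cts_fun.
have r30 : 0 < r / 3 by rewrite divr_gt0.
have [p [L L0 [plip pg]]] := lipschitz_approximation c0 r30.
pose k := exponents (2 - beta).
(* The staircase is at most 2 on the unit interval, so this amplitude keeps the
   sum of both errors below r. *)
pose eps := r / 9; have eps0 : 0 < eps by rewrite divr_gt0.
have k_steps : unit_steps k by apply: exponents_unit_steps; lra.
have k_oo m : exists n, (m <= k n)%N by exact: exponents_unbounded.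
pose h x := p x + eps * staircase k x.
have ch : continuous (h \o set_val : `[0, 1]%classic -> R).
  apply/subspace_sigL_continuousP; apply: continuous_subspaceT.
  exact: (perturbed_continuous k_steps k_oo L0 eps0 plip).
pose f : C01 R := (mkcts ch : continuousType `[0, 1 : R]%classic R).
exists f; split; last first.
  rewrite -[X in X f]/(fun f : C01 R => has_dim dim (graph01 f) beta).
  have fh : graph01 f = graphR h by exact: graph01_restriction.
  have := perturbed_has_dim dim b12 eps0 L0 plip.
  by rewrite -[X in graphR X]/h -fh.
apply: rO; rewrite ballEmdist/= /mdist/=.
apply: (@le_lt_trans _ _ (r / 3 + eps * 2)); last by rewrite /eps; lra.
apply: supdist_le => x.
have x01 : set_val x \in `[0, 1] := set_valP x.
have fx : C01_fun f0 x = valL_ (0 : R) f0 (set_val x).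
  by rewrite /C01_fun -[in LHS](valLK 0 f0).
have := pg _ x01; rewrite -fx distrC.
rewrite -[C01_fun f x]/(h (set_val x)) /h => pgx.
have /andP[g0 g2] : 0 <= staircase k (set_val x) <= 2 by exact: staircase01.
have -> : C01_fun f0 x - (p (set_val x) + eps * staircase k (set_val x)) =
  (C01_fun f0 x - p (set_val x)) - eps * staircase k (set_val x) by ring.
apply: (le_trans (ler_normB _ _)); apply: lerD => //.
rewrite ger0_norm; last by rewrite mulr_ge0 ?(ltW eps0).
by rewrite ler_pM2l.
Qed.
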